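(* Let $r>1$, and assume that the most reliable cubic graph near zero with $2(r-1)$ vertices is not tree-balanced. Then there exists $n_0$ such that for all $n>n_0$, no uniformly most reliable graph exists with $n$ vertices and $r$ redundant edges.
   Context: Graphs are finite undirected multigraphs. The number of redundant edges of a graph with $n$ vertices and $m$ edges is $r=m-(n-1)$, an integer. If each edge of $G$ fails independently with probability $p$, $U_G(p)$ denotes the probability that $G$ is disconnected. A graph with $n$ vertices and $m$ edges is uniformly most reliable if it minimizes $U_G(p)$ among all graphs with $n$ vertices and $m$ edges, for every $p\in[0,1]$. A cubic graph is a 3-regular graph. A cubic graph is the most reliable cubic graph near zero if there is $p'>0$ such that it minimizes $U_G(p)$ among all cubic graphs with the same number of vertices, for all $p\in[0,p']$. $T(G)$ denotes the number of spanning trees of $G$, and $G-e$ denotes $G$ with the edge $e$ removed. $G$ is tree-balanced if $T(G-e_1)=T(G-e_2)$ for every pair of edges $e_1,e_2\in E(G)$, where $E(G)$ is the edge set of $G$. *)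

(* Defs.v *)
From HB Require Import structures.
From mathcomp Require Import all_boot all_order all_algebra.
From mathcomp Require Import boolp reals.

Set Implicit Arguments.
Unset Strict Implicit.
Unset Printing Implicit Defensive.

Import Order.TTheory GRing.Theory Num.Theory.

(* Parallel edges and loops are allowed. The order of the two components of
   [ends e] carries no meaning: every notion below is invariant under swapping
   them. *)
Record mgraph := MGraph {
  vertex : finType;
  edge : finType;
  ends : edge -> vertex * vertex
}.

Definition joins (G : mgraph) (e : edge G) (x y : vertex G) : bool :=
  (ends e == (x, y)) || (ends e == (y, x)).

(* A loop contributes 2 to the degree of its vertex. *)
Definition degree (G : mgraph) (v : vertex G) : nat :=
  #|[set e : edge G | (ends e).1 == v]| + #|[set e : edge G | (ends e).2 == v]|.

Definition cubic (G : mgraph) : Prop := forall v : vertex G, degree v = 3.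

Definition redundant_edges (G : mgraph) : int :=
  (#|edge G|%:Z - (#|vertex G|%:Z - 1))%R.

Definition adjacent_in (G : mgraph) (S : {set edge G}) : rel (vertex G) :=
  fun x y => [exists e in S, joins e x y].

(* Connectedness of the spanning subgraph with edge set S. *)
Definition connected_by (G : mgraph) (S : {set edge G}) : bool :=
  [forall x, forall y, connect (adjacent_in S) x y].

(* S is the set of surviving edges. *)
Definition unreliability (R : realType) (G : mgraph) (p : R) : R :=
  (\sum_(S : {set edge G} | ~~ connected_by S)
     p ^+ #|~: S| * (1 - p) ^+ #|S|)%R.

(* [:: (e_1, v_1); ...; (e_k, v_k)] with k >= 1, where e_i joins v_i to v_(i+1)
   and e_k joins v_k to v_1; loops (k = 1) and pairs of parallel edges (k = 2)
   are cycles. *)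
Definition graph_cycle (G : mgraph) (c : seq (edge G * vertex G)) : bool :=
  [&& c != [::], uniq (unzip1 c), uniq (unzip2 c)
    & cycle (fun a b => joins a.1 a.2 b.2) c].

Definition acyclic (G : mgraph) (S : {set edge G}) : Prop :=
  forall c : seq (edge G * vertex G),
    graph_cycle c -> ~ {subset unzip1 c <= S}.

Definition spanning_tree (G : mgraph) (S : {set edge G}) : Prop :=
  connected_by S /\ acyclic S.

Definition nb_spanning_trees (G : mgraph) : nat :=
  #|[set S : {set edge G} | `[< spanning_tree S >]]|.

Definition remove_edge (G : mgraph) (e : edge G) : mgraph :=
  @MGraph (vertex G) {f : edge G | f != e} (fun f => ends (val f)).

Definition tree_balanced (G : mgraph) : Prop :=
  forall e1 e2 : edge G,
    nb_spanning_trees (remove_edge e1) = nb_spanning_trees (remove_edge e2).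

Definition uniformly_most_reliable (R : realType) (G : mgraph) : Prop :=
  forall H : mgraph, #|vertex H| = #|vertex G| -> #|edge H| = #|edge G| ->
  forall p : R, (0 <= p <= 1)%R ->
    (unreliability G p <= unreliability H p)%R.

Definition most_reliable_cubic_near_zero (R : realType) (G : mgraph) : Prop :=
  cubic G /\
  exists2 p' : R, (0 < p')%R &
    forall H : mgraph, cubic H -> #|vertex H| = #|vertex G| ->
    forall p : R, (0 <= p <= p')%R ->
      (unreliability G p <= unreliability H p)%R.

(* Main.v *)
Require Import Defs.
From mathcomp Require Import all_boot all_order all_algebra.
From mathcomp Require Import boolp reals.
From mathcomp Require Import perm zify ring lra.

(* Let [F_G(x)] sum [x^|complement of S|] over the connected spanning edge sets
   [S], so that [U_G(p) = 1 - (1 - p)^m F_G(p / (1 - p))]. Contracting the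
   vertices of degree at most 2 and splitting those of degree at least 4 by edges
   of length 0 writes [F_G] as [F_(D,l)(x) = sum_S prod_(e notin S) (l e * x)]
   with [D] cubic on [2 (r - 1)] vertices and lengths [l >= 0] of total at most
   [m]. Conversely every positively weighted cubic graph is a subdivision.
   If [G] is uniformly most reliable, then comparing the coefficients of [x] and
   [x^2] with those of an almost balanced subdivision of a 3-edge-connected graph
   forces all [l e <= q + s], where [m = 3 (r - 1) q + s]. For [q] large,
   comparing with subdivisions of [H] at [x = y / q] forces [F_D = F_H], since
   otherwise [F_H(y) - F_D(y)] is positive and bounded below at some small [y].
   Hence [D] and [H] have equally many spanning trees. If [H] is not tree-balanced,
   moving a bounded length from one edge of [H] to another gains a term of order
   [q^(r - 1)] in the number of spanning trees of the subdivision, more than the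
   bounded deviations of [l] from [q] can contribute: a contradiction. *)

Set Implicit Arguments.
Unset Strict Implicit.
Unset Printing Implicit Defensive.

Import Order.TTheory GRing.Theory Num.Theory.

(** * Connected spanning subgraphs and contraction *)

(** Connectedness tested by two-colourings: a colouring that does not change along surviving edges
    propagates along paths, and conversely reachability from [x] is such a colouring. Most later
    connectivity arguments modify colourings instead of paths. *)
Lemma connected_byP (G : mgraph) (S : {set edge G}) :
  reflect (forall f : vertex G -> bool,
             {in S, forall e, f (ends e).1 = f (ends e).2} ->
             forall x y, f x = f y)
          (connected_by S).
Proof.
apply: (iffP idP) => [/forallP cS f fS x y | cS].
  have /connectP [p pp ->] := forallP (cS x) y.
  elim: p x pp => //= z p IHp x /andP [/exists_inP [e eS]] ez /IHp <-.
  by case/orP: ez => /eqP ee; have := fS e eS; rewrite ee.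
apply/forallP => x; apply/forallP => y.
rewrite -(cS (connect (adjacent_in S) x) _ x y) // => e eS.
have adj a b : joins e a b -> connect (adjacent_in S) a b.
  by move=> jab; apply: connect1; apply/exists_inP; exists e.
have je : joins e (ends e).1 (ends e).2 by rewrite /joins -surjective_pairing eqxx.
have je' : joins e (ends e).2 (ends e).1 by rewrite /joins -surjective_pairing eqxx orbT.
by apply/idP/idP => /connect_trans; apply; apply: adj.
Qed.

Lemma connected_byS (G : mgraph) (S T : {set edge G}) :
  S \subset T -> connected_by S -> connected_by T.
Proof.
move=> sST /connected_byP cS; apply/connected_byP => f fT.
by apply: cS => e /(subsetP sST); apply: fT.
Qed.

(** A relation rather than a construction, so that building the smaller graph ([contract_graph]) and
    building the larger one ([subdivide], [split_vertex]) share the same lemmas. *)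
Record contraction (G' G : mgraph) (e : edge G')
    (phi : vertex G' -> vertex G) (psi : edge G -> edge G') : Prop := Contraction {
  contr_surj : forall y, exists x, phi x = y;
  contr_loop : phi (ends e).1 = phi (ends e).2;
  contr_fib : forall x y, phi x = phi y -> x = y \/ joins e x y;
  contr_inj : injective psi;
  contr_neq : forall g, psi g != e;
  contr_im : forall f, f != e -> exists g, psi g = f;
  contr_ends : forall g, ends g = (phi (ends (psi g)).1, phi (ends (psi g)).2)
}.

Section Contraction.
Variables (G' G : mgraph) (e : edge G').
Variables (phi : vertex G' -> vertex G) (psi : edge G -> edge G').
Hypothesis C : contraction e phi psi.

Lemma connected_by_contraction (S : {set edge G'}) :
  e \in S -> connected_by S = connected_by (psi @^-1: S).
Proof.
move=> eS; apply/connected_byP/connected_byP => cS f fS x y.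
  have [x' <-] := contr_surj C x; have [y' <-] := contr_surj C y.
  apply: (cS (f \o phi)) => a aS /=.
  have [->|/(contr_im C) [g ga]] := eqVneq a e; first by rewrite (contr_loop C).
  have := fS g; rewrite inE ga (contr_ends C) /= ga; exact.
have fe a b : joins e a b -> f a = f b.
  by have := fS e eS; rewrite /joins => fe /orP [] /eqP ee; rewrite ee in fe.
have fphi a b : phi a = phi b -> f a = f b.
  by case/(contr_fib C) => [->|/fe].
(* The colouring [f] agrees on the ends of [e], hence on the fibres of [phi], and descends to
   [g]. *)
pose g (z : vertex G) := [exists a, (phi a == z) && f a].
have gphi a : g (phi a) = f a.
  apply/existsP/idP => [[b /andP [/eqP /fphi <-]]|fa] //.
  by exists a; rewrite eqxx.
rewrite -!gphi; apply: cS => h; rewrite inE => hS.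
by rewrite (contr_ends C) /= !gphi; apply: fS.
Qed.

Definition uncontract (T : {set edge G}) : {set edge G'} := e |: psi @: T.

Lemma uncontractK T : psi @^-1: (uncontract T) = T.
Proof.
apply/setP => g; rewrite !inE (negbTE (contr_neq C g)) /=.
by rewrite (mem_imset _ _ (contr_inj C)).
Qed.

Lemma contractK (S : {set edge G'}) : e \in S -> uncontract (psi @^-1: S) = S.
Proof.
move=> eS; apply/setP => f; rewrite !inE.
have [->//|/(contr_im C) [g <-]] := eqVneq f e.
by rewrite (mem_imset _ _ (contr_inj C)) inE.
Qed.

Lemma setC_uncontract T : ~: uncontract T = psi @: (~: T).
Proof.
apply/setP => f; rewrite !inE.
have [->|/(contr_im C) [g <-]] := eqVneq f e.
  by apply/esym/imsetP => -[g _ /eqP]; rewrite eq_sym (negbTE (contr_neq C g)).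
by rewrite !(mem_imset _ _ (contr_inj C)) inE.
Qed.

Lemma card_uncontract T : #|uncontract T| = #|T|.+1.
Proof.
rewrite cardsU1 card_imset; last exact: contr_inj C.
rewrite (_ : e \in _ = false) //; apply/imsetP => -[g _ /eqP].
by rewrite eq_sym (negbTE (contr_neq C g)).
Qed.

Lemma card_edge_contraction : #|edge G'| = #|edge G|.+1.
Proof.
by rewrite -cardsT -(contractK (in_setT e)) card_uncontract preimsetT cardsT.
Qed.

End Contraction.

(** Multivariate form of [F_G]: one weight per failed edge. Weight 0 means that the edge never
    fails. *)
Definition conn_poly (R : comNzRingType) (G : mgraph) (w : edge G -> R) : R :=
  (\sum_(S : {set edge G} | connected_by S) \prod_(e in ~: S) w e)%R.

Local Open Scope ring_scope.

Section ContractionPoly.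
Variables (R : comNzRingType) (G' G : mgraph) (e : edge G').
Variables (phi : vertex G' -> vertex G) (psi : edge G -> edge G').
Hypothesis C : contraction e phi psi.

Lemma sum_contraction (P : pred {set edge G'}) (w : edge G' -> R) :
  \sum_(S : {set edge G'} | [&& e \in S, connected_by S & P S])
     \prod_(f in ~: S) w f
  = \sum_(T : {set edge G} | connected_by T && P (uncontract e psi T))
     \prod_(g in ~: T) w (psi g).
Proof.
rewrite (reindex_onto (uncontract e psi) (fun S => psi @^-1: S)) /=; last first.
  by move=> S /and3P [eS _ _]; exact: (contractK C).
apply: eq_big => [T|T _].
  rewrite (uncontractK C) eqxx andbT !inE eqxx /=.
  by rewrite (connected_by_contraction C) ?(uncontractK C) // !inE eqxx.
rewrite (setC_uncontract C) big_imset //=; apply: in2W; exact: contr_inj C.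
Qed.

(** The connected sets containing [e] are those of the contraction. The sum over those avoiding [e]
    vanishes when [w e = 0] or [e] is pendant, and merges with the first term for a series pair. *)
Lemma conn_poly_contraction (w : edge G' -> R) :
  conn_poly w = conn_poly (w \o psi)
    + \sum_(S : {set edge G'} | connected_by S && (e \notin S))
         \prod_(f in ~: S) w f.
Proof.
rewrite /conn_poly (bigID (fun S : {set _} => e \in S)) /=; congr (_ + _).
rewrite (eq_bigl (fun S : {set edge G'} => [&& e \in S, connected_by S & predT S])) => [|S].
  by rewrite sum_contraction; apply: eq_bigl => T; rewrite andbT.
by rewrite /= andbT andbC.
Qed.

Lemma conn_poly_contraction0 (w : edge G' -> R) :
  w e = 0 -> conn_poly w = conn_poly (w \o psi).
Proof.
move=> we0; rewrite conn_poly_contraction big1 ?addr0 // => S /andP [_ eS].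
by rewrite (bigD1 e) ?inE //= we0 mul0r.
Qed.

End ContractionPoly.

Definition incident (G : mgraph) (e : edge G) (v : vertex G) :=
  ((ends e).1 == v) || ((ends e).2 == v).

Lemma isolated_disconnected (G : mgraph) (S : {set edge G}) v x :
  x != v -> {in S, forall f, ~~ incident f v} -> ~~ connected_by S.
Proof.
move=> xv nS; apply/negP => /connected_byP cS.
suff : v == v = (x == v) by rewrite eqxx (negbTE xv).
apply: (cS (eq_op^~ v)) => f /nS.
by rewrite /incident negb_or => /andP [/negbTE -> /negbTE ->].
Qed.

Lemma conn_poly_pendant (R : comNzRingType) (G' G : mgraph) (e : edge G') phi
    (psi : edge G -> edge G') v x (w : edge G' -> R) :
  contraction e phi psi -> x != v -> (forall f, incident f v -> f = e) ->
  conn_poly w = conn_poly (w \o psi).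
Proof.
move=> C xv ev; rewrite (conn_poly_contraction C) big1 ?addr0 // => S /andP [cS eS].
suff : ~~ connected_by S by rewrite cS.
by apply: (isolated_disconnected xv) => f fS; apply: contraNN eS => /ev <-.
Qed.

(** Only [e1] and [e2] meet [v], so in [S] the vertex [v] hangs as a leaf from [e2]; the exchange
    hangs it from [e1] instead, and the rest stays connected. *)
Lemma connected_by_swap (G : mgraph) (e1 e2 : edge G) v u1 u2 (S : {set edge G}) :
  e1 != e2 -> joins e1 v u1 -> joins e2 v u2 -> u1 != v -> u2 != v ->
  (forall f, incident f v -> f = e1 \/ f = e2) ->
  e1 \notin S -> e2 \in S -> connected_by S ->
  connected_by (tperm e1 e2 @: S).
Proof.
move=> e12 j1 j2 u1v u2v inc e1S e2S /connected_byP cS.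
apply/connected_byP => f fS.
(* Recolouring [v] like [u2] makes the colouring constant along [e2], so the connectedness of [S]
   applies. *)
pose g x := if x == v then f u2 else f x.
have g_const : forall x y, g x = g y.
  apply: cS => h hS.
  have [he|he2] := eqVneq h e2.
    by case/orP: j2 => /eqP; rewrite he => -> /=; rewrite /g eqxx (negbTE u2v).
  have he1 : h != e1 by apply: contraNneq e1S => <-.
  have ninc : ~~ incident h v.
    by apply/negP => /inc [] /eqP; rewrite ?(negbTE he1) ?(negbTE he2).
  move: ninc; rewrite /incident negb_or /g => /andP [/negbTE -> /negbTE ->].
  by apply: fS; apply/imsetP; exists h => //; rewrite tpermD 1?eq_sym.
have fv : f v = f u1.
  have e1S' : e1 \in tperm e1 e2 @: S by apply/imsetP; exists e2; rewrite ?tpermR.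
  by have := fS e1 e1S'; case/orP: j1 => /eqP ->.
have gf x : f x = g u1.
  have [->|xv] := eqVneq x v; first by rewrite fv /g (negbTE u1v).
  by rewrite -(g_const x) /g (negbTE xv).
by move=> x y; rewrite !gf.
Qed.

(* Connected sets avoiding [e1] contain [e2]; exchanging the two edges makes them
   contain [e1], so that they too can be contracted. *)
Lemma conn_poly_series (R : comNzRingType) (G' G : mgraph) (e1 e2 : edge G') phi
    (psi : edge G -> edge G') v u1 u2 (w : edge G' -> R) (w' : edge G -> R) :
  contraction e1 phi psi ->
  e1 != e2 -> joins e1 v u1 -> joins e2 v u2 -> u1 != v -> u2 != v ->
  (forall f, incident f v -> f = e1 \/ f = e2) ->
  (forall g, w' g = if psi g == e2 then w e1 + w e2 else w (psi g)) ->
  conn_poly w = conn_poly w'.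
Proof.
move=> C e12 j1 j2 u1v u2v inc w'E; rewrite (conn_poly_contraction C).
have [g2 g2E] : exists g, psi g = e2 by apply: (contr_im C); rewrite eq_sym.
pose s := tperm e1 e2.
have sK : involutive (fun S : {set edge G'} => s @: S).
  by move=> S; rewrite -imset_comp -[RHS]imset_id; apply: eq_imset => x /=; rewrite tpermK.
have memS (S : {set edge G'}) f : (f \in s @: S) = (s f \in S).
  by rewrite -{1}(tpermK e1 e2 f) -/s (mem_imset _ _ (@perm_inj _ s)).
have -> : \sum_(S : {set edge G'} | connected_by S && (e1 \notin S)) \prod_(f in ~: S) w f
  = \sum_(T : {set edge G} | connected_by T && (g2 \notin T)) \prod_(g in ~: T) w (s (psi g)).
  (* Avoiding [g2] in the contraction means avoiding [e2] in [G']; the sum is lifted to [G'] and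
     reindexed by the exchange of [e1] and [e2]. *)
  under [RHS]eq_bigl => T.
    have -> : (g2 \notin T) = (e2 \notin uncontract e1 psi T).
      by rewrite -g2E -{1}(uncontractK C T) inE.
    over.
  rewrite -(sum_contraction C (fun S => e2 \notin S) (w \o s)).
  rewrite (reindex_inj (can_inj sK)) /=; apply: eq_big => [S|S _].
    rewrite memS tpermL.
    have [e2S|] := boolP (e2 \in S); first by rewrite /= !andbF.
    move=> e2S; rewrite /= !andbT; have [e1S|e1S] := boolP (e1 \in S); last first.
      apply/negP => cS.
      suff : ~~ connected_by (s @: S) by rewrite cS.
      apply: (isolated_disconnected u1v) => f; rewrite memS => fS.
      by apply/negP => /inc [] fE; rewrite fE ?tpermL ?tpermR ?(negbTE e1S) ?(negbTE e2S) in fS.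
    apply/idP/idP => cS.
      rewrite -[S]sK /= {1}/s.
      apply: (connected_by_swap (v := v) (u1 := u1) (u2 := u2)) => //.
      - by rewrite memS tpermL.
      - by rewrite memS tpermR.
    rewrite /s tpermC.
    apply: (connected_by_swap (v := v) (u1 := u2) (u2 := u1)) => //.
    - by rewrite eq_sym.
    - by move=> f /inc []; [right|left].
  have -> : ~: (s @: S) = s @: (~: S) by apply/setP => f; rewrite !(inE, memS).
  by rewrite big_imset //=; apply: in2W; apply: perm_inj.
pose out (T : {set edge G}) := g2 \notin T.
(* Sets missing [g2] occur twice on the left, with factors [w e2] and [w e1], which add up to the
   weight of the merged edge; sets containing [g2] occur once. *)
rewrite /conn_poly (bigID out) [RHS](bigID out) /=.
rewrite addrAC -big_split /=; congr (_ + _); apply: eq_bigr => T /andP [_ g2T].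
  rewrite !(bigD1 (P := mem (~: T)) g2) ?inE //= g2E tpermR w'E g2E eqxx.
  set A := \prod_(_ | _) _; set B := \prod_(_ | _) _; set D := \prod_(_ | _) _.
  have nE g : g != g2 -> psi g != e2.
    by apply: contraNneq => gE; apply/eqP/(contr_inj C); rewrite gE g2E.
  have -> : A = D.
    apply: eq_bigr => g /andP [_ /nE gg2].
    by rewrite w'E (negbTE gg2).
  have -> : B = D.
    apply: eq_bigr => g /andP [_ /nE gg2].
    by rewrite w'E (negbTE gg2) tpermD 1?eq_sym // (contr_neq C).
  by rewrite -mulrDl [w e2 + _]addrC.
apply: eq_bigr => g; rewrite inE => gT; rewrite w'E /= ifN //.
apply: contraNneq gT => gE; move: g2T; rewrite negbK.
by rewrite (_ : g = g2) //; apply: (contr_inj C); rewrite gE g2E.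
Qed.

(** * Contracting, subdividing and splitting *)

Lemma sum_contraction_edges (G' G : mgraph) (e : edge G') phi (psi : edge G -> edge G')
    (F : edge G' -> nat) :
  contraction e phi psi ->
  (\sum_f F f = F e + \sum_g F (psi g))%N.
Proof.
move=> C; rewrite (bigD1 e) //=; congr (_ + _)%N.
transitivity (\sum_(f in psi @: setT) F f)%N.
  apply: eq_bigl => f; apply/idP/imsetP => [/(contr_im C) [g <-]|[g _ ->]].
    by exists g.
  exact: contr_neq C g.
rewrite big_imset /=; last by apply: in2W; exact: contr_inj C.
by apply: eq_bigl => g; rewrite inE.
Qed.

Section ContractGraph.
Variables (G : mgraph) (e : edge G) (v u : vertex G).
Hypothesis uv : u != v.

(** The default value of [insubd] sends [v] to [u]; every other vertex is fixed. *)
Definition contract_vertex (x : vertex G) : {y : vertex G | y != v} :=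
  insubd (exist (fun y => y != v) u uv) x.

Definition contract_graph : mgraph :=
  @MGraph {y : vertex G | y != v} {f : edge G | f != e}
    (fun f => (contract_vertex (ends (val f)).1, contract_vertex (ends (val f)).2)).

Lemma contract_graphP : joins e v u ->
  @contraction G contract_graph e contract_vertex val.
Proof.
move=> evu.
have phiv : contract_vertex v = exist _ u uv.
  by apply: val_inj; rewrite val_insubd eqxx.
split=> //=.
- by move=> y; exists (val y); apply: valKd.
- have phiu : contract_vertex u = exist _ u uv by apply: valKd (exist _ u uv).
  by case/orP: evu => /eqP -> /=; rewrite phiv phiu.
- move=> x y /(congr1 val); rewrite !val_insubd /=.
  have [->|xv] := eqVneq x v; have [->|yv] := eqVneq y v => /=; rewrite ?eqxx /=; auto.
  + by move=> <-; right.
  + by move=> ->; right; rewrite /joins orbC.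
- exact: val_inj.
- by move=> g; exact: (valP g).
- by move=> f fe; exists (exist _ f fe).
Qed.

Lemma card_contract_graph : (#|vertex G| = #|vertex contract_graph|.+1)%N.
Proof.
rewrite /= card_sig (cardC1 v) prednK //.
by apply/card_gt0P; exists v.
Qed.

End ContractGraph.

(** A pair [(e, b)] is a half-edge of [e]. A loop has two half-edges at its vertex, in agreement
    with [degree]. *)
Definition attach (G : mgraph) (h : edge G * bool) : vertex G :=
  if h.2 then (ends h.1).2 else (ends h.1).1.

Lemma degreeE (G : mgraph) (v : vertex G) :
  degree v = (\sum_e (((ends e).1 == v) + ((ends e).2 == v)))%N.
Proof.
have cardE (p : pred (edge G)) : #|[set e | p e]| = (\sum_e p e)%N.
  by rewrite -sum1dep_card big_mkcond; apply: eq_bigr => e _; case: (p e).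
by rewrite /degree !cardE -big_split.
Qed.

Lemma degree_attach (G : mgraph) (v : vertex G) :
  degree v = #|[set h | attach h == v]|.
Proof.
rewrite degreeE -sum1dep_card [RHS]big_mkcond.
rewrite [RHS](eq_bigr (fun h => if attach (h.1, h.2) == v then 1 else 0))%N; last by case.
rewrite -(pair_bigA _ (fun e b => if attach (e, b) == v then 1 else 0))%N /=.
by apply: eq_bigr => e _; rewrite big_bool addnC /attach /=; do 2!case: (_ == v).
Qed.

Lemma sum_degree (G : mgraph) : (\sum_(v : vertex G) degree v = 2 * #|edge G|)%N.
Proof.
under eq_bigr do rewrite degreeE.
rewrite exchange_big /= -sum1_card big_distrr /=; apply: eq_bigr => e _.
have one (x : vertex G) : (\sum_v (x == v) = 1)%N.
  rewrite (bigD1 x) //= eqxx big1 ?addn0 // => y yx.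
  by rewrite eq_sym (negbTE yx).
by rewrite big_split /= !one.
Qed.

Section Subdivide.
Variables (G : mgraph) (e : edge G).

(** The edge [e] keeps its first end and now stops at the new vertex; the new edge [None] leads on
    to the old second end. *)
Definition subdivide : mgraph :=
  @MGraph (option (vertex G)) (option (edge G))
    (fun o => if o is Some f then
                (Some (ends f).1, if f == e then None else Some (ends f).2)
              else (None, Some (ends e).2)).

Lemma subdivideP :
  @contraction subdivide G None (odflt (ends e).2) Some.
Proof.
split=> //=.
- by move=> y; exists (Some y).
- by move=> [x|] [y|] /=; [move=> ->; left|move=> ->; right; rewrite /joins /= !xpair_eqE !eqxx ?orbT
   |move=> <-; right; rewrite /joins /= !xpair_eqE !eqxx ?orbT|left].
- by move=> f g [].
- by case=> // f _; exists f.
- move=> g; case: eqP => [->|_] /=; exact: surjective_pairing.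
Qed.

Lemma conn_poly_subdivide (F : comNzRingType) (w : option (edge G) -> F)
    (w' : edge G -> F) :
  (forall g, w' g = if g == e then w None + w (Some e) else w (Some g)) ->
  @conn_poly F subdivide w = conn_poly w'.
Proof.
move=> w'E.
apply: (conn_poly_series (e1 := None : edge subdivide) (e2 := Some e : edge subdivide)
  (v := None : vertex subdivide)
  (u1 := Some (ends e).2 : vertex subdivide) (u2 := Some (ends e).1 : vertex subdivide) subdivideP) => //.
- by rewrite /joins /= !xpair_eqE !eqxx.
- by rewrite /joins /= !xpair_eqE !eqxx ?orbT.
- case=> [f|]; last by left.
  by rewrite /incident /=; have [->|] := eqVneq f e; [right|].
Qed.

End Subdivide.

Section SplitVertex.
Variables (G : mgraph) (v : vertex G) (h1 h2 : edge G * bool).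
Hypotheses (h12 : h1 != h2) (h1v : attach h1 = v) (h2v : attach h2 = v).

Definition split_attach (h : edge G * bool) : option (vertex G) :=
  if (h == h1) || (h == h2) then None else Some (attach h).

(** The half-edges [h1] and [h2] move from [v] to a new vertex joined to [v] by the edge [None]. The
    new vertex has degree 3, and [v] loses two half-edges but gains one. *)
Definition split_vertex : mgraph :=
  @MGraph (option (vertex G)) (option (edge G))
    (fun o => if o is Some f then (split_attach (f, false), split_attach (f, true))
              else (Some v, None)).

Lemma split_vertexP : @contraction split_vertex G None (odflt v) Some.
Proof.
split=> //=.
- by move=> y; exists (Some y).
- by move=> [x|] [y|] /=; [move=> ->; left|move=> ->; right; rewrite /joins /= !xpair_eqE !eqxx ?orbT
   |move=> <-; right; rewrite /joins /= !xpair_eqE !eqxx ?orbT|left].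
- by move=> f g [].
- by case=> // f _; exists f.
- have phiE h : odflt v (split_attach h) = attach h.
    by rewrite /split_attach; case: ifP => //= /orP [] /eqP ->.
  by move=> g; rewrite !phiE; exact: surjective_pairing.
Qed.

Lemma sum_half_edges (h : edge G * bool) :
  (\sum_f (((f, false) == h) + ((f, true) == h)) = 1)%N.
Proof.
case: h => e b; rewrite (bigD1 e) //= big1 => [|f /negbTE fe].
  by rewrite !xpair_eqE eqxx; case: b.
by rewrite !xpair_eqE fe.
Qed.

Lemma degree_split_Some x :
  (degree (Some x : vertex split_vertex) + (v == x) = degree x)%N.
Proof.
rewrite !degreeE (sum_contraction_edges _ split_vertexP) /= addn0.
have E h : ((split_attach h == Some x) + ((h == h1) + (h == h2)) * (v == x)
    = (attach h == x) :> nat)%N.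
  rewrite /split_attach; have [->|_] := eqVneq h h1.
    by rewrite (negbTE h12) h1v /=; lia.
  have [->|_] := eqVneq h h2; first by rewrite h2v /=; lia.
  by rewrite (_ : (Some _ == Some x) = (attach h == x)) //=; lia.
have two : (\sum_f ((((f, false) == h1) + ((f, false) == h2)) * (v == x) +
    (((f, true) == h1) + ((f, true) == h2)) * (v == x)) = 2 * (v == x))%N.
  rewrite (_ : 2%N = (1 + 1)%N) // -{1}(sum_half_edges h1) -(sum_half_edges h2).
  rewrite -big_split /= big_distrl /=; apply: eq_bigr => f _; lia.
have -> : (\sum_e (((ends e).1 == x) + ((ends e).2 == x)) =
   \sum_f ((split_attach (f, false) == Some x) + (split_attach (f, true) == Some x))
   + 2 * (v == x))%N.
  rewrite -two -big_split /=; apply: eq_bigr => f _.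
  have := E (f, false); have := E (f, true); rewrite /attach /=.
  case: (v == x) => /=; lia.
rewrite (_ : (Some v == Some x) = (v == x)) //.
by rewrite addnAC addnC addnn -mul2n.
Qed.

Lemma degree_split_None : degree (None : vertex split_vertex) = 3.
Proof.
rewrite degreeE (sum_contraction_edges _ split_vertexP) /=.
suff -> : (\sum_f ((split_attach (f, false) == None) + (split_attach (f, true) == None))
    = 1 + 1)%N by [].
rewrite -{1}(sum_half_edges h1) -(sum_half_edges h2).
rewrite -big_split /=; apply: eq_bigr => f _.
have E h : ((split_attach h == None) = (h == h1) + (h == h2) :> nat)%N.
  rewrite /split_attach; have [->|_] := eqVneq h h1; first by rewrite (negbTE h12).
  by case: (h == h2).
rewrite !E; lia.
Qed.

End SplitVertex.

(** * Reduction to weighted cubic graphs *)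

(** An edge of positive length [l e] stands for a path of [l e] edges: at most one of them may be
    missing from a connected set, in [l e] ways. *)
Definition length_poly (F : comNzRingType) (x : F) (G : mgraph) (l : edge G -> nat) : F :=
  conn_poly (fun e => (l e)%:R * x).

(** The point [x] lives in an arbitrary ring so that [x = 'X] yields one core valid at all
    points. *)
Definition cubic_core (F : comNzRingType) (x : F) (r : nat) (G : mgraph)
    (l : edge G -> nat) : Prop :=
  exists (D : mgraph) (k : edge D -> nat),
    [/\ cubic D, #|vertex D| = (2 * (r - 1))%N, (\sum_e k e <= \sum_e l e)%N
      & length_poly x l = length_poly x k].

Lemma cubic_core_trans (F : comNzRingType) (x : F) r (G G' : mgraph)
    (l : edge G -> nat) (l' : edge G' -> nat) :
  (\sum_e l' e <= \sum_e l e)%N -> length_poly x l = length_poly x l' ->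
  cubic_core x r l' -> cubic_core x r l.
Proof.
move=> ll' lP [D [k [Dc Dn kl' kP]]]; exists D, k; split=> //.
  exact: leq_trans kl' ll'.
by rewrite lP.
Qed.

(** A vertex of degree at least 4 is split by an edge of length 0, which preserves the polynomial,
    the redundancy and the degree bound. When all degrees are 3, the handshake identity fixes the
    number of vertices. *)
Lemma cubic_core_degree_ge3 (F : comNzRingType) (x : F) r (G : mgraph) (l : edge G -> nat) :
  (forall v : vertex G, 3 <= degree v)%N -> (#|edge G| + 1 = #|vertex G| + r)%N ->
  cubic_core x r l.
Proof.
have [k] := ubnP (2 * r - #|vertex G|)%N.
elim: k G l => // k IHk G l kG deg3 cG.
(* With the edge count this gives [#|vertex G| + 2 <= 2 * r], so the induction measure is positive
   and each split lowers it. *)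
have le3 : (3 * #|vertex G| <= 2 * #|edge G|)%N.
  rewrite -sum_degree mulnC -sum_nat_const.
  exact: leq_sum.
have [|/forallPn [v dv]] := boolP [forall v : vertex G, degree v == 3].
  move=> /forallP deg; exists G, l; split=> //; first by move=> v; apply/eqP.
  suff : (#|vertex G| * 3 = 2 * #|edge G|)%N by lia.
  by rewrite -sum_nat_const -sum_degree; apply: eq_bigr => v _; rewrite (eqP (deg v)).
have {}dv : (3 < degree v)%N by rewrite ltn_neqAle eq_sym dv deg3.
have lt3 : (3 * #|vertex G| < 2 * #|edge G|)%N.
  rewrite -sum_degree mulnC -sum_nat_const (bigD1 v) //= [X in (_ < X)%N](bigD1 v) //=.
  by rewrite -addSn leq_add // leq_sum.
have /card_gt1P [h1 [h2 [h1v h2v h12]]] : (1 < #|[set h | attach h == v]|)%N.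
  by rewrite -degree_attach; lia.
move: h1v h2v; rewrite !inE => /eqP h1v /eqP h2v.
have C := split_vertexP h1v h2v.
set G' := split_vertex v h1 h2 in C.
pose l' (o : edge G') := if o is Some f then l f else 0%N.
have Vc : #|vertex G'| = #|vertex G|.+1 by rewrite card_option.
have Ec : #|edge G'| = #|edge G|.+1 by rewrite card_option.
apply: (@cubic_core_trans _ _ _ _ G' l l').
- by rewrite (sum_contraction_edges _ C).
- by rewrite /length_poly (conn_poly_contraction0 C) //= mul0r.
- apply: IHk => [||]; rewrite ?Vc ?Ec; [lia| |lia].
  case=> [u|]; last by rewrite degree_split_None.
  have := degree_split_Some h12 h1v h2v u; have := deg3 u.
  have [<-|_] := eqVneq v u; rewrite -/G'; lia.
Qed.

Lemma connected_contraction (G G' : mgraph) (e : edge G') phi (psi : edge G -> edge G') :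
  contraction e phi psi -> connected_by [set: edge G'] -> connected_by [set: edge G].
Proof. by move=> C; rewrite (connected_by_contraction C) ?inE // preimsetT. Qed.

Lemma connected_cut (G : mgraph) (S : {set edge G}) v x :
  connected_by S -> x != v -> exists h, [/\ h.1 \in S, attach h = v & attach (h.1, ~~ h.2) != v].
Proof.
move=> /connected_byP cS xv; apply: contrapT => nh.
suff : (v == v) = (x == v) by rewrite eqxx (negbTE xv).
apply: (cS (eq_op^~ v)) => e eS /=.
have [ev|ev] := eqVneq (ends e).1 v; have [ev'|ev'] := eqVneq (ends e).2 v => //.
- by case: nh; exists (e, false).
- by case: nh; exists (e, true).
Qed.

Lemma joins_attach (G : mgraph) (h : edge G * bool) :
  joins h.1 (attach h) (attach (h.1, ~~ h.2)).
Proof. by case: h => e [] /=; rewrite /joins /attach /= -surjective_pairing eqxx ?orbT. Qed.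

Lemma incident_attach (G : mgraph) e (v : vertex G) :
  incident e v -> exists b, attach (e, b) = v.
Proof. by case/orP => /eqP; [exists false|exists true]. Qed.

(** Induction on the number of vertices: at a vertex of degree 1 the pendant edge is contracted, and
    at one of degree 2 the two edges are merged and their lengths added. *)
Lemma cubic_core_connected (F : comNzRingType) (x : F) r (G : mgraph) (l : edge G -> nat) :
  (1 < r)%N -> connected_by [set: edge G] -> (#|edge G| + 1 = #|vertex G| + r)%N ->
  cubic_core x r l.
Proof.
move=> r1; have [k] := ubnP #|vertex G|.
elim: k G l => // k IHk G l kG cG nG.
have [|/forallPn [v]] := boolP [forall v : vertex G, 3 <= degree v]%N.
  by move/forallP => deg3; apply: cubic_core_degree_ge3.
rewrite -ltnNge => dv.
(* On a single vertex all [r] edges would be loops, giving degree [2 * r > 2]. *)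
have /existsP [y yv] : [exists y, y != v].
  apply: contraT => /existsPn yv.
  have V1 : forall y, y = v by move=> y; apply/eqP; rewrite -[_ == _]negbK yv.
  have V1c : #|vertex G| = 1%N.
    by rewrite -cardsT (_ : setT = [set v]) ?cards1 //; apply/setP => z; rewrite !inE (V1 z) eqxx.
  suff : (#|vertex G| * degree v = 2 * #|edge G|)%N by lia.
  by rewrite -sum_nat_const -sum_degree; apply: eq_bigr => z _; rewrite (V1 z).
have [h1 [_ h1v h1n]] := connected_cut cG yv.
have j1 : joins h1.1 v (attach (h1.1, ~~ h1.2)) by rewrite -{1}h1v; apply: joins_attach.
have := contract_graphP h1n j1; set G' := contract_graph _ _ => C.
have Vc : #|vertex G| = #|vertex G'|.+1 by apply: card_contract_graph.
have Ec := card_edge_contraction C.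
have cG' := connected_contraction C cG.
pose other h := (h != h1) && (attach h == v).
have [h2 /andP [h21 /eqP h2v]|none] := pickP other; last first.
  apply: (@cubic_core_trans _ _ _ _ G' l (l \o val)).
  - by rewrite (sum_contraction_edges _ C) leq_addl.
  - apply: (conn_poly_pendant _ C yv) => f /incident_attach [b fv].
    by have := none (f, b); rewrite /other fv eqxx andbT => /negbFE/eqP <-.
  - by apply: IHk => //; lia.
have only h : attach h = v -> h = h1 \/ h = h2.
  move=> hv; apply: contrapT => /not_orP [/eqP hh1 /eqP hh2].
  have : (#|[set h1; h2; h]| <= degree v)%N.
    rewrite degree_attach subset_leq_card //; apply/subsetP => h'.
    by rewrite !inE -orbA => /or3P [] /eqP ->; apply/eqP.
  rewrite -setUA cardsU1 cards2 !inE negb_or eq_sym h21 eq_sym hh1 eq_sym hh2; lia.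
(* A loop at [h2] would have both half-edges among [h1] and [h2], making [h1] a half-edge of a loop;
   the same reason separates the two edges below. *)
have h2n : attach (h2.1, ~~ h2.2) != v.
  apply/eqP => /only [hE|].
    by have := h1n; rewrite -hE /= negbK -surjective_pairing h2v eqxx.
  by case: (h2) => e [].
have e12 : h1.1 != h2.1.
  apply: contraNneq (h1n) => e12; apply/eqP; rewrite -h2v e12.
  congr attach; move: h21 e12; case: (h1) (h2) => e b [e' b'] /= + ee; rewrite ee.
  by rewrite xpair_eqE eqxx; case: b b' => [] [].
pose l' (g : edge G') := if val g == h2.1 then (l h1.1 + l h2.1)%N else l (val g).
apply: (@cubic_core_trans _ _ _ _ G' l l').
- have [g2 g2E] : exists g : edge G', val g = h2.1 by apply: (contr_im C); rewrite eq_sym.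
  rewrite (sum_contraction_edges _ C) (bigD1 g2) //= [X in (_ <= _ + X)%N](bigD1 g2) //=.
  have -> : l' g2 = (l h1.1 + l (val g2))%N by rewrite /l' g2E eqxx.
  rewrite -addnA !leq_add2l leq_sum // => g gg2; rewrite /l' ifN //.
  by rewrite -g2E; apply: contra gg2 => /eqP/val_inj ->.
- apply: (conn_poly_series C e12 (v := v) (u1 := attach (h1.1, ~~ h1.2))
    (u2 := attach (h2.1, ~~ h2.2))) => //.
  + by rewrite -{1}h2v; apply: joins_attach.
  + by move=> f /incident_attach [b /only [] <-]; [left|right].
  + by move=> g; rewrite /l'; case: ifP => // _; rewrite natrD mulrDl.
- by apply: IHk => //; lia.
Qed.

(** Each subdivision cuts one unit off an edge of length at least 2; the process ends when all
    lengths are 1. *)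
Lemma subdivision_exists (F : comNzRingType) (x : F) (G : mgraph) (l : edge G -> nat) :
  (forall e, 0 < l e)%N ->
  exists G' : mgraph, [/\ #|edge G'| = (\sum_e l e)%N,
    (#|vertex G'| + #|edge G| = #|vertex G| + \sum_e l e)%N
    & @length_poly F x G' (fun=> 1%N) = length_poly x l].
Proof.
have [k] := ubnP (\sum_e l e - #|edge G|)%N.
elim: k G l => // k IHk G l kl l0.
have [/forallP l1|/forallPn [e le]] := boolP [forall e, l e == 1%N].
  have sl : (\sum_e l e = #|edge G|)%N.
    by rewrite -sum1_card; apply: eq_bigr => e _; apply/eqP.
  exists G; rewrite sl; split=> //; apply: eq_bigr => S _; apply: eq_bigr => e _.
  by rewrite (eqP (l1 e)).
have {}le : (1 < l e)%N by rewrite ltn_neqAle eq_sym le l0.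
pose l' (o : edge (subdivide e)) :=
  if o is Some f then (if f == e then (l f).-1 else l f) else 1%N.
have sl : (\sum_e l e = \sum_o l' o)%N.
  rewrite (sum_contraction_edges _ (subdivideP e)) /= (bigD1 e) //= [in RHS](bigD1 e) //=.
  rewrite eqxx addnA add1n prednK ?l0 //; congr (_ + _)%N.
  by apply: eq_bigr => f /negbTE ->.
have ll : (#|edge G| < \sum_e l e)%N.
  rewrite -sum1_card (bigD1 e) //= [ltnRHS](bigD1 e) //= -addSn leq_add //.
  exact: leq_sum.
have Ec : #|edge (subdivide e)| = #|edge G|.+1 by rewrite card_option.
have Vc : #|vertex (subdivide e)| = #|vertex G|.+1 by rewrite card_option.
have [||G' [EG' VG' PG']] := IHk (subdivide e) l'.
- by rewrite -sl Ec; lia.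
- by case=> [f|//] /=; have := l0 f; case: eqP => [->|_]; lia.
exists G'; split; [by rewrite sl|by move: VG'; rewrite -sl Ec Vc; lia|].
rewrite PG'; apply: conn_poly_subdivide => g /=; rewrite eqxx.
case: eqP => [->|//]; rewrite -mulrDl -natrD add1n prednK //; lia.
Qed.

(** * Spanning trees *)

(** Both claims follow by contracting an edge of [S] that leaves [v], which lowers [#|vertex G|] and
    [#|S|] by one each. *)
Lemma connected_by_card (G : mgraph) (S : {set edge G}) :
  (0 < #|vertex G|)%N -> connected_by S ->
  (#|vertex G| <= #|S| + 1)%N /\
  exists T : {set edge G}, [/\ T \subset S, connected_by T & (#|T| + 1 = #|vertex G|)%N].
Proof.
have [k] := ubnP #|vertex G|; elim: k G S => // k IHk G S kG /card_gt0P [v _] cS.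
have [/existsP [y yv]|/existsPn V1] := boolP [exists y, y != v]; last first.
  have Vc : #|vertex G| = 1%N.
    rewrite -cardsT (_ : setT = [set v]) ?cards1 //; apply/setP => z.
    by rewrite !inE -[_ == _]negbK V1.
  rewrite Vc addn1; split=> //; exists set0; rewrite sub0set cards0; split=> //.
  apply/connected_byP => f _ a b.
  by have := V1 a; have := V1 b; rewrite !negbK => /eqP -> /eqP ->.
have [h [hS hv hn]] := connected_cut cS yv.
have j : joins h.1 v (attach (h.1, ~~ h.2)) by rewrite -{1}hv; apply: joins_attach.
have := contract_graphP hn j; set G' := contract_graph _ _ => C.
have Vc : #|vertex G| = #|vertex G'|.+1 by apply: card_contract_graph.
have V0 : (0 < #|vertex G'|)%N by apply/card_gt0P; exists (contract_vertex hn v).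
rewrite (connected_by_contraction C hS) in cS.
have [|le [T [TS cT Tc]]] := IHk G' _ _ V0 cS; first by lia.
have Sc := card_uncontract C (val @^-1: S); rewrite (contractK C hS) in Sc.
split; first by rewrite Vc Sc addSn ltnS.
exists (uncontract h.1 (val : edge G' -> edge G) T); split.
- rewrite -(contractK C hS); apply: setUS; apply: imsetS; exact: TS.
- by rewrite (connected_by_contraction C) ?(uncontractK C) // !inE eqxx.
- by rewrite (card_uncontract C) Vc -Tc.
Qed.

(** A colouring constant along the rest of the cycle already agrees at the ends of the removed
    edge. *)
Lemma connected_by_cycle (G : mgraph) (S : {set edge G}) c :
  graph_cycle c -> {subset unzip1 c <= S} -> connected_by S ->
  exists2 e, e \in S & connected_by (S :\ e).
Proof.
case: c => // -[e v] c /and4P [_ /= /andP [ec _] _ cyc] cS /connected_byP Sc.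
exists e; first by apply: cS; rewrite inE eqxx.
apply/connected_byP => f fS; apply: Sc => h hS.
have [->|he] := eqVneq h e; last by apply: fS; rewrite !inE he.
have fj g a b : g \in S :\ e -> joins g a b -> f a = f b.
  by move=> /fS gS /orP [] /eqP gE; rewrite gE in gS.
have walk (p : edge G * vertex G) q : {subset unzip1 (p :: q) <= S :\ e} ->
    path (fun a b => joins a.1 a.2 b.2) p (rcons q (e, v)) -> f p.2 = f v.
  elim: q p => [|q0 q IHq] p sub /= /andP [jp pq].
    by apply: fj jp; apply: sub; rewrite inE eqxx.
  rewrite (fj _ _ _ (sub p.1 _) jp) ?inE ?eqxx //; apply: IHq => // g gq.
  by apply: sub; rewrite inE gq orbT.
move: cyc; case: c ec cS => [|p q] ec cS /= /andP [je pq].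
  by case/orP: je => /eqP -> .
have fv : f p.2 = f v.
  apply: walk pq => g gp; apply/setD1P; split.
    by apply: contraNneq ec => <-.
  by apply: cS; rewrite in_cons gp orbT.
by case/orP: je => /eqP -> /=.
Qed.

(** Turns a simple vertex path into the format of [graph_cycle]; the last clause lets an edge
    arriving at [x] close it up. Edges do not repeat because the first one meets [x], which later
    ones avoid. *)
Lemma path_edges (G : mgraph) (S : {set edge G}) (x : vertex G) p :
  path (adjacent_in S) x p -> uniq (x :: p) ->
  exists c : seq (edge G * vertex G),
    [/\ unzip2 c = belast x p, {subset unzip1 c <= S}, uniq (unzip1 c),
        forall e, e \in unzip1 c -> forall y, incident e y -> y \in x :: p
      & forall a b : edge G * vertex G, joins a.1 a.2 x -> b.2 = last x p ->
          path (fun a b => joins a.1 a.2 b.2) a (rcons c b)].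
Proof.
elim: p x => [|y p IHp] x /=; first by exists [::]; split=> //= a b ax ->; rewrite ax.
move=> /andP [/exists_inP [e eS jxy] pp] /andP [xp up].
have [c [c2 c1 cu ci cp]] := IHp y pp up.
exists ((e, x) :: c); split=> /=.
- by rewrite c2.
- by move=> f; rewrite inE => /orP [/eqP ->|/c1].
- rewrite cu andbT; apply: contraNN xp => /ci; apply.
  by case/orP: jxy => /eqP; rewrite /incident => -> /=; rewrite eqxx ?orbT.
- move=> f; rewrite inE => /orP [/eqP ->|/ci fi] z; last by move/fi; rewrite [in X in _ -> X]in_cons => ->; rewrite orbT.
  rewrite /incident; case/orP: jxy => /eqP -> /= /orP [] /eqP <-; rewrite !inE eqxx ?orbT //.
- by move=> a b -> bl /=; apply: cp.
Qed.

(** A connected set of minimal size loses connectedness with any edge, so it has no cycle.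
    Conversely an edge outside a tree [T] contained in [S] would close a cycle. *)
Lemma spanning_treeE (G : mgraph) (S : {set edge G}) : (0 < #|vertex G|)%N ->
  spanning_tree S <-> connected_by S /\ (#|S| + 1 = #|vertex G|)%N.
Proof.
move=> V0; split=> [[cS aS]|[cS Sc]]; split=> //; last first.
  move=> c gc sub; have [e eS cSe] := connected_by_cycle gc sub cS.
  have [+ _] := connected_by_card V0 cSe.
  have := cardsD1 e S; rewrite eS; lia.
have [_ [T [TS cT Tc]]] := connected_by_card V0 cS.
suff ST : S \subset T by rewrite (_ : S = T) //; apply/eqP; rewrite eqEsubset ST.
apply/subsetP => e eS; apply: contrapT => /negP eT.
have cSe : connected_by (S :\ e).
  apply: connected_byS cT; apply/subsetP => f fT; rewrite !inE (subsetP TS) // andbT.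
  by apply: contraNneq eT => <-.
(* A path from the second end of [e] back to the first, avoiding [e]; once made simple, it is closed
   by [e] itself. *)
have /forallP/(_ (ends e).2)/forallP/(_ (ends e).1)/connectP [p0 pp0 pl0] := cSe.
case: (shortenP pp0) pl0 => p pp up _ pl.
have [c [c2 c1 cu ci cp]] := path_edges pp up.
apply: (aS ((e, (ends e).1) :: c)); last first.
  by move=> f; rewrite inE => /orP [/eqP -> //|/c1]; rewrite inE => /andP [].
apply/and4P; split=> //=.
- rewrite cu andbT; apply/negP => /c1; by rewrite !inE eqxx.
- rewrite c2 pl; move: up; rewrite lastI rcons_uniq; exact.
- by apply: (cp (e, (ends e).1) (e, (ends e).1)); rewrite //= /joins -surjective_pairing eqxx.
Qed.

Lemma nb_spanning_trees_remove_edge (G : mgraph) (e : edge G) : (0 < #|vertex G|)%N ->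
  nb_spanning_trees (remove_edge e) =
  #|[set S : {set edge G} | [&& connected_by S, e \notin S & #|S| + 1 == #|vertex G|]]|%N.
Proof.
move=> V0; have vinj : injective (fun S : {set edge (remove_edge e)} => val @: S).
  by apply: imset_inj; apply: val_inj.
have conn (S : {set edge (remove_edge e)}) : connected_by (val @: S) = connected_by S.
  apply/connected_byP/connected_byP => cS f fS; apply: cS.
    by move=> _ /imsetP [g gS ->]; apply: (fS g gS).
  by move=> g gS; apply: fS; apply: imset_f.
rewrite /nb_spanning_trees -(card_imset _ vinj); apply: eq_card => S; rewrite inE.
apply/imsetP/and3P => [[T]|[cS eS /eqP Sc]].
  rewrite inE => /asboolP/(spanning_treeE T V0) [cT Tc] ->.
  rewrite conn cT card_imset ?Tc; last exact: val_inj.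
  split=> //; apply/imsetP => -[g _ eg]; have := valP g; by rewrite /= -eg eqxx.
have SE : S = val @: (val @^-1: S : {set edge (remove_edge e)}).
  apply/setP => f; apply/idP/imsetP => [fS|[g + ->]]; last by rewrite inE.
  have fe : f != e by apply: contraNneq eS => <-.
  by exists (exist _ f fe); rewrite ?inE.
exists (val @^-1: S) => //; rewrite inE; apply/asboolP/(@spanning_treeE (remove_edge e) _ V0).
by rewrite -conn -SE; split=> //; rewrite -Sc {2}SE card_imset //; apply: val_inj.
Qed.

(** * Moebius ladders *)

Lemma constant_on_segment (T : Type) (g : nat -> T) a b :
  (a <= b)%N -> (forall j, a <= j < b -> g j = g j.+1)%N -> g a = g b.
Proof.
elim: b => [|b IHb]; first by rewrite leqn0 => /eqP ->.
rewrite leq_eqVlt => /orP [/eqP -> //|ab] gE.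
rewrite IHb //; first by apply: gE; rewrite ltnSn andbT.
by move=> j /andP [aj jb]; apply: gE; rewrite aj ltnW.
Qed.

(** If the first change [i] were the only one in the period, then [g i.+1 = g t = g 0 = g i]. *)
Lemma periodic_changes (g : nat -> bool) t i0 j0 : (0 < t)%N ->
  (forall j, g (j + t)%N = g j) -> g i0 != g j0 ->
  exists i j, [/\ (i < j < t)%N, g i != g i.+1 & g j != g j.+1].
Proof.
move=> t0 per gij.
have gmod j : g j = g (j %% t)%N.
  rewrite {1}(divn_eq j t) addnC; elim: (j %/ t)%N => [|m IHm]; first by rewrite mul0n addn0.
  by rewrite mulSn [(t + _)%N]addnC addnA per.
have ex : exists i, (i < t)%N && (g i != g i.+1).
  apply: contrapT => nex; case/eqP: gij.
  have g0 j : g j = g 0%N.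
    rewrite gmod; symmetry; apply: constant_on_segment => // i /andP [_ it].
    apply/eqP; apply: contrapT => /negP gi; apply: nex; exists i.
    by rewrite gi (ltn_trans it) // ltn_pmod.
  by rewrite !g0.
have [i /andP [it gi] imin] := ex_minnP ex.
have g0 : g 0%N = g i.
  apply: constant_on_segment => // j /andP [_ ji]; apply: contraTeq (ji) => gj.
  by rewrite -leqNgt imin // gj (ltn_trans ji it).
apply: contrapT => nex; case/eqP: (gi).
rewrite -g0 -(per 0%N) add0n.
symmetry; apply: constant_on_segment => // j /andP [ij jt]; apply/eqP.
by apply: contrapT => /negP gj; apply: nex; exists i, j; rewrite ij jt gi gj.
Qed.

Section Moebius.
Variable k : nat.
Hypothesis k0 : (0 < k)%N.

Definition moebius_vertex (j : nat) : 'I_(2 * k) :=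
  Ordinal (ltn_pmod j (leq_trans k0 (leq_pmull k (ltn0Sn 1)))).

(** A rim of length [2 * k] with rungs between opposite vertices: a cubic 3-edge-connected graph for
    every [k > 0], namely three parallel edges when [k = 1]. *)
Definition moebius_ladder : mgraph :=
  @MGraph 'I_(2 * k) ('I_(2 * k) + 'I_k)%type
    (fun e => match e with
              | inl i => (moebius_vertex i, moebius_vertex i.+1)
              | inr i => (moebius_vertex i, moebius_vertex (i + k))
              end).

(* A nonconstant [f] changes at least twice along the rim. If moreover no rung is
   crossed, [f] is [k]-periodic and changes at least twice per period, so at least
   four times in all. *)
Lemma moebius_connected (S : {set edge moebius_ladder}) :
  (#|~: S| <= 2)%N -> connected_by S.
Proof.
move=> Sc; apply/connected_byP => f fS x y; apply/eqP; apply: contraTT Sc => fxy.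
rewrite -ltnNge.
have nS e : f (ends e).1 != f (ends e).2 -> e \notin S.
  by apply: contraNN => /fS ->.
have three (a b c : edge moebius_ladder) : a != b -> a != c -> b != c ->
    a \notin S -> b \notin S -> c \notin S -> (2 < #|~: S|)%N.
  move=> ab ac bc aS bS cS.
  have <- : #|[set a; b; c]| = 3%N.
    by rewrite -setUA cardsU1 cards2 !inE negb_or ab ac bc.
  by apply/subset_leq_card/subsetP => z; rewrite !inE -orbA => /or3P [] /eqP ->.
pose g j := f (moebius_vertex j).
have per2 j : g (j + 2 * k)%N = g j.
  by congr f; apply: val_inj; rewrite /= modnDr.
have gx (z : 'I_(2 * k)) : g z = f z.
  by congr f; apply: val_inj; rewrite /= modn_small.
have gxy : g x != g y by rewrite !gx.
have rail i : (i < 2 * k)%N -> g i != g i.+1 ->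
    exists2 o : 'I_(2 * k), val o = i & (inl o : edge moebius_ladder) \notin S.
  by move=> ik gi; exists (Ordinal ik) => //; apply: nS.
have [per|/forallPn [i gi]] := boolP [forall i : 'I_k, g i == g (i + k)%N]; last first.
  have [a [b [/andP [ab bk] ga gb]]] :=
    periodic_changes (leq_trans k0 (leq_pmull k (ltn0Sn 1))) per2 gxy.
  have [oa oaE oaS] := rail a (ltn_trans ab bk) ga.
  have [ob obE obS] := rail b bk gb.
  apply: (three (inl oa) (inl ob) (inr i)) => //; last exact: nS.
  by apply: contraTneq ab => -[/(congr1 val)]; rewrite /= oaE obE => ->; rewrite ltnn.
have {}per j : g (j + k)%N = g j.
  have [q [r [rk ->]]] : exists q r, (r < k)%N /\ j = (r + q * k)%N.
    by exists (j %/ k)%N, (j %% k)%N; rewrite ltn_pmod // addnC -divn_eq.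
  elim: q {j} => [|q IHq].
    by rewrite mul0n addn0; have /eqP := forallP per (Ordinal rk).
  rewrite mulSn [(k + _)%N]addnC !addnA [RHS]IHq -[RHS]per2; congr g; clear; lia.
have [a [b [/andP [ab bk] ga gb]]] := periodic_changes k0 per gxy.
(* Repeating one of the two changes a period later gives the third crossed edge. *)
have gak : g (a + k)%N != g (a + k).+1 by rewrite -addSn !per.
have [|oa oaE oaS] := rail a _ ga; first by move: ab bk; clear; lia.
have [|ob obE obS] := rail b _ gb; first by move: ab bk; clear; lia.
have [|oc ocE ocS] := rail (a + k)%N _ gak; first by move: ab bk; clear; lia.
apply: (three (inl oa) (inl ob) (inl oc)) => //.
- apply/eqP => -[/(congr1 val)]; rewrite /= oaE obE; move: ab; clear; lia.
- apply/eqP => -[/(congr1 val)]; rewrite /= oaE ocE; move: k0; clear; lia.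
- apply/eqP => -[/(congr1 val)]; rewrite /= obE ocE; move: ab bk; clear; lia.
Qed.

Lemma card_moebius_edge : #|edge moebius_ladder| = (3 * k)%N.
Proof. by rewrite card_sum !card_ord; lia. Qed.

End Moebius.

(** * Coefficients of the survival polynomial *)

(** For [P = xpredT] this is the elementary symmetric polynomial of degree [k] in the lengths, an
    upper bound for [conn_coef]. *)
Definition set_coef (T : finType) (P : pred {set T}) (l : T -> nat) (k : nat) : nat :=
  (\sum_(S : {set T} | P S && (#|~: S| == k)) \prod_(e in ~: S) l e)%N.

Definition conn_coef (G : mgraph) : (edge G -> nat) -> nat -> nat :=
  set_coef (@connected_by G).

Lemma coef_set_coef (F : comNzRingType) (T : finType) (P : pred {set T}) (l : T -> nat) k :
  (\sum_(S : {set T} | P S) \prod_(e in ~: S) ((l e)%:R * 'X : {poly F}))`_k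
  = (set_coef P l k)%:R.
Proof.
rewrite coef_sum /set_coef natr_sum big_mkcondr; apply: eq_bigr => S _.
rewrite big_split prodr_const -natr_prod /= mulr_natl coefMn coefXn eq_sym.
by case: eqP => _; rewrite ?mul0rn.
Qed.

Lemma coef_length_poly (F : comNzRingType) (G : mgraph) (l : edge G -> nat) k :
  (length_poly ('X : {poly F}) l)`_k = (conn_coef l k)%:R.
Proof. exact: coef_set_coef. Qed.

Lemma horner_length_poly (F : comNzRingType) (G : mgraph) (l : edge G -> nat) (x : F) :
  (length_poly 'X l).[x] = length_poly x l.
Proof.
rewrite horner_sum; apply: eq_bigr => S _; rewrite horner_prod; apply: eq_bigr => e _.
by rewrite !mulr_natl hornerMn hornerX.
Qed.

Lemma sum_prod_setC (F : comNzRingType) (T : finType) (w : T -> F) :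
  \sum_(S : {set T}) \prod_(e in ~: S) w e = \prod_e (1 + w e).
Proof.
rewrite bigA_distr; apply: eq_bigr => S _; rewrite big_mkcond; apply: eq_bigr => e _.
by rewrite inE; case: (e \in S).
Qed.

(** In the odds [x = p / (1 - p)] the sum over all edge sets is [(1 + x) ^ m], with [m] the number
    of edges. Thus, for fixed [m], minimizing unreliability means maximizing this polynomial. *)
Lemma unreliability_length_poly (R : realType) (G : mgraph) (x : R) : 0 <= x ->
  unreliability G (x / (1 + x)) =
  1 - (1 + x)^-1 ^+ #|edge G| * @length_poly R x G (fun=> 1%N).
Proof.
move=> x0; have x1 : 1 + x != 0 by rewrite lt0r_neq0 // ltr_wpDr.
have termE (S : {set edge G}) : (x / (1 + x)) ^+ #|~: S| * (1 - x / (1 + x)) ^+ #|S| =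
    (1 + x)^-1 ^+ #|edge G| * \prod_(e in ~: S) (1%:R * x).
  rewrite prodr_const mul1r -(cardsC S) (_ : 1 - x / (1 + x) = (1 + x)^-1); last by field.
  rewrite exprMn exprD; ring.
rewrite /unreliability (eq_bigr _ (fun S _ => termE S)) -mulr_sumr.
have := sum_prod_setC (fun e : edge G => 1%:R * x).
rewrite (bigID (@connected_by G)) /= prodr_const mul1r => /(canRL (addKr _)) ->.
rewrite mulrDr mulrN addrC -exprMn mulVf // expr1n.
congr (_ - _ * _); apply: eq_bigr => S _; apply: eq_bigr => e _; exact: esym (mul1r x).
Qed.

(** On the unit interval each of the at most [n] remaining terms is bounded by [B * x ^+ k.+1]. *)
Lemma norm_horner_low (R : realFieldType) (p : {poly R}) (n : nat) (B : R) k x :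
  (size p <= n)%N -> (forall i, `|p`_i| <= B) -> (forall i, (i < k)%N -> p`_i = 0) ->
  0 <= x <= 1 -> `|p.[x] - p`_k * x ^+ k| <= n%:R * B * x ^+ k.+1.
Proof.
move=> pn pB pk /andP [x0 x1]; have B0 : 0 <= B := le_trans (normr_ge0 _) (pB 0%N).
have [nk|kn] := leqP n k.
  have -> : p = 0.
    apply/polyP => i; rewrite coef0; have [/pk //|ki] := ltnP i k.
    by rewrite nth_default // (leq_trans pn) // (leq_trans nk).
  by rewrite horner0 coef0 mul0r subrr normr0 !mulr_ge0 ?exprn_ge0.
rewrite (horner_coef_wide _ pn) (bigD1 (Ordinal kn)) //= addrAC subrr add0r.
apply: le_trans (ler_norm_sum _ _ _) _.
apply: (@le_trans _ _ (\sum_(i < n) B * x ^+ k.+1)); last first.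
  by rewrite sumr_const card_ord -[leLHS]mulr_natl mulrA.
rewrite [leRHS](bigD1 (Ordinal kn)) //= ler_wpDl ?mulr_ge0 ?exprn_ge0 //.
apply: ler_sum => i ik; have [ik'|ki] := ltnP i k.
  by rewrite pk // mul0r normr0 mulr_ge0 ?exprn_ge0.
rewrite normrM ler_pM // normrX ger0_norm // ler_wiXn2l //.
by rewrite ltn_neqAle ki andbT; apply: contraNneq ik => ik; apply/eqP/val_inj.
Qed.

Lemma ler_coef_low (R : realFieldType) (p q : {poly R}) k :
  (forall x, 0 < x -> p.[x] <= q.[x]) -> (forall i, (i < k)%N -> p`_i = q`_i) ->
  p`_k <= q`_k.
Proof.
move=> pq pqk; rewrite leNgt; apply/negP => dk.
pose d := p - q; pose B := \sum_(i < size d) `|d`_i|.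
have dB i : `|d`_i| <= B.
  have [di|id] := leqP (size d) i.
    by rewrite nth_default // normr0 sumr_ge0.
  by rewrite /B (bigD1 (Ordinal id)) //= lerDl sumr_ge0.
have B0 : 0 <= B by apply: sumr_ge0.
have dk0 : 0 < d`_k by rewrite coefB subr_gt0.
pose c := (size d)%:R * B; have c0 : 0 <= c by rewrite mulr_ge0.
(* Small enough that [x <= 1] and the error [c * x] stays below the leading difference. *)
pose x := d`_k / (c + d`_k + 1).
have den0 : 0 < c + d`_k + 1 by lra.
have x0 : 0 < x by rewrite divr_gt0.
have x1 : x <= 1 by rewrite ler_pdivrMr // mul1r; lra.
have cx : c * x < d`_k.
  by rewrite mulrA ltr_pdivrMr // [c * _]mulrC ltr_pM2l //; lra.
have dlow i : (i < k)%N -> d`_i = 0 by move=> ik; rewrite coefB pqk // subrr.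
have x01 : 0 <= x <= 1 by rewrite (ltW x0).
have := norm_horner_low (leqnn _) dB dlow x01.
rewrite ler_norml => /andP [+ _]; rewrite -/c exprS mulrA.
have := pq x x0; rewrite -subr_le0 -hornerN -hornerD -/d => dx.
have xk : 0 < x ^+ k by rewrite exprn_gt0.
have : 0 < (d`_k - c * x) * x ^+ k by rewrite mulr_gt0 ?subr_gt0.
nra.
Qed.

(** Reversing the coefficients, [x ^+ r * p.[x^-1]], turns the top coefficient into the constant
    one. *)
Lemma ler_coef_top (R : realFieldType) (p q : {poly R}) r :
  (size p <= r.+1)%N -> (size q <= r.+1)%N ->
  (forall x, 0 < x -> p.[x] <= q.[x]) -> p`_r <= q`_r.
Proof.
pose rv (p : {poly R}) := \poly_(i < r.+1) p`_(r - i).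
have rvE (s : {poly R}) x : (size s <= r.+1)%N -> 0 < x -> (rv s).[x] = x ^+ r * s.[x^-1].
  move=> sr x0; rewrite horner_poly (horner_coef_wide _ sr) mulr_sumr (reindex_inj rev_ord_inj) /=.
  apply: eq_bigr => i _; have ir : (i <= r)%N by rewrite -ltnS.
  rewrite subSS subKn // mulrCA; congr (_ * _).
  by rewrite exprVn -exprB ?unitfE ?lt0r_neq0.
move=> pr qr pq; have := @ler_coef_low R (rv p) (rv q) 0.
rewrite !coef_poly /= subn0; apply=> // x x0.
by rewrite !rvE // ler_pM2l ?exprn_gt0 // pq // invr_gt0.
Qed.

Lemma coef_prod_linear (T : eqType) (s : seq T) (l : T -> nat) :
  let p : {poly int} := \prod_(e <- s) (1 + (l e)%:R * 'X) in
  [/\ p`_0 = 1, p`_1 = (\sum_(e <- s) l e)%:R &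
      2%:R * p`_2 + (\sum_(e <- s) l e ^ 2)%:R = (\sum_(e <- s) l e)%:R ^+ 2].
Proof.
elim: s => [|e s [IH0 IH1 IH2]] /=.
  by rewrite !big_nil !coef1; split.
rewrite !big_cons; set p := \prod_(_ <- _) _ in IH0 IH1 IH2 *.
have E k : ((1 + (l e)%:R * 'X) * p)`_k.+1 = p`_k.+1 + (l e)%:R * p`_k.
  by rewrite mulrDl mul1r coefD -mulrA mulr_natl coefMn coefXM /= mulr_natl.
split; rewrite ?E ?IH0 ?IH1.
- by rewrite mulrDl mul1r coefD -mulrA mulr_natl coefMn coefXM /= mul0rn addr0 IH0.
- by rewrite natrD mulr1 addrC.
- move: IH2; rewrite !natrD natrX; lia.
Qed.

Lemma set_coefT (T : finType) (l : T -> nat) :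
  [/\ set_coef xpredT l 0 = 1, set_coef xpredT l 1 = \sum_e l e &
      2 * set_coef xpredT l 2 + \sum_e l e ^ 2 = (\sum_e l e) ^ 2]%N.
Proof.
have [] := coef_prod_linear (index_enum T) l; rewrite -sum_prod_setC !coef_set_coef.
move=> c0 c1 c2; split; apply/eqP; rewrite -(eqr_nat int) ?c0 ?c1 //.
by rewrite natrD natrM natrX c2.
Qed.


Lemma set_coef_le (T : finType) (P Q : pred {set T}) (l : T -> nat) k :
  (forall S, P S -> #|~: S| = k -> Q S) -> (set_coef P l k <= set_coef Q l k)%N.
Proof.
move=> PQ; rewrite /set_coef [leqRHS]big_mkcond [leqLHS]big_mkcond.
apply: leq_sum => S _; case: andP => // -[/PQ QS /eqP k_]; by rewrite QS // k_ eqxx.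
Qed.

(** In the binomial expansion every term except [q ^ n.+1] has a power of [q] at most [q ^ n], and
    the remaining coefficients sum to [(a + 1) ^ n.+1 - 1]. *)
Lemma expn_add_le q a n : (0 < q)%N ->
  ((q + a) ^ n.+1 + q ^ n <= q ^ n.+1 + (a + 1) ^ n.+1 * q ^ n)%N.
Proof.
move=> q0; elim: n => [|n IHn]; first by rewrite !expn1 !expn0; lia.
rewrite expnS [(q ^ n.+2)%N]expnS [((a + 1) ^ n.+2)%N]expnS.
move: IHn; rewrite [(q ^ n.+1)%N]expnS.
have C0 : (0 < (a + 1) ^ n.+1)%N by rewrite expn_gt0 addn1.
move: C0; set A := ((q + a) ^ n.+1)%N; set C := ((a + 1) ^ n.+1)%N; set Y := (q ^ n)%N.
move=> C0 IHn.
have h1 : ((q + a) * (A + Y) <= (q + a) * (q * Y + C * Y))%N by rewrite leq_mul2l IHn orbT.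
have h2 : ((q + C) * (a * Y) <= (C * q + 1) * (a * Y))%N by rewrite leq_mul2r; apply/orP; right; nia.
move: h1 h2; rewrite !mulnDl !mulnDr; nia.
Qed.

(** * Weighted cubic graphs of uniformly most reliable graphs *)

Lemma length_poly_of_unreliability (R : realType) (G G' : mgraph) (x : R) :
  #|edge G| = #|edge G'| -> 0 <= x ->
  unreliability G (x / (1 + x)) <= unreliability G' (x / (1 + x)) ->
  @length_poly R x G' (fun=> 1%N) <= @length_poly R x G (fun=> 1%N).
Proof.
move=> EE x0; rewrite !unreliability_length_poly // EE lerD2l lerN2 ler_pM2l //.
by rewrite exprn_gt0 // invr_gt0 ltr_wpDr.
Qed.

Lemma most_reliable_length_poly (R : realType) (G K : mgraph) (l : edge K -> nat) (x : R) :
  uniformly_most_reliable R G -> (forall e, 0 < l e)%N ->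
  (\sum_e l e = #|edge G|)%N -> (#|vertex K| + #|edge G| = #|vertex G| + #|edge K|)%N ->
  0 <= x -> length_poly x l <= @length_poly R x G (fun=> 1%N).
Proof.
move=> mG l0 sl VE x0; have [G' [EG' VG' <-]] := subdivision_exists x l0.
have x1 : 0 < 1 + x by rewrite ltr_wpDr.
apply: length_poly_of_unreliability; rewrite ?EG' ?sl //; apply: mG; rewrite ?EG' //.
  by move: VG'; rewrite sl; lia.
by rewrite divr_ge0 ?(ltW x1) //= ler_pdivrMr // mul1r lerDr.
Qed.

Lemma sum_eq_or_const (T : finType) (e0 : T) (a b : nat) :
  (\sum_e (if e == e0 then a else b) + b = #|T| * b + a)%N.
Proof.
rewrite (bigD1 e0) //= eqxx (eq_bigr (fun=> b)) => [|f /negbTE -> //].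
rewrite sum_nat_const (cardC1 e0) -addnA addnC -mulSnr prednK //.
by apply/card_gt0P; exists e0.
Qed.

(** The hypotheses bound the sum of [(l e - q) ^ 2] by its value [s ^ 2] for [l'], so no single
    deviation exceeds [s]. *)
Lemma le_of_sum_sqr_le (T T' : finType) (l : T -> nat) (q s : nat) (e0 : T') :
  let l' (e : T') := if e == e0 then (q + s)%N else q in
  #|T| = #|T'| -> (\sum_e l e = \sum_e l' e)%N ->
  (\sum_e l e ^ 2 <= \sum_e l' e ^ 2)%N -> forall e, (l e <= q + s)%N.
Proof.
move=> l' TT suml sqrl e; rewrite leqNgt; apply/negP => le.
have sumc (f : nat) : (\sum_(e : T) f = #|T| * f)%N by rewrite sum_nat_const.
have sl' : (\sum_e l' e + q = #|T| * q + (q + s))%N by rewrite sum_eq_or_const TT.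
have sl2' : (\sum_e l' e ^ 2 + q ^ 2 = #|T| * q ^ 2 + (q + s) ^ 2)%N.
  rewrite TT -(sum_eq_or_const e0); congr (_ + _)%N.
  by apply: eq_bigr => f _; rewrite /l'; case: ifP.
have : (2 * q * \sum_f l f + (l e - q) ^ 2 <= \sum_f l f ^ 2 + #|T| * q ^ 2)%N.
  rewrite -sumc -big_split big_distrr /= (bigD1 e) //= [leqRHS](bigD1 e) //= addnAC.
  apply: leq_add; last by apply: leq_sum => f _; rewrite -mulnA addnC nat_Cauchy.
  have [z ->] : exists z, l e = (q + z)%N by exists (l e - q)%N; lia.
  nia.
have [z lz] : exists z, (l e = q + s + z.+1)%N by exists (l e - (q + s)).-1; lia.
rewrite suml lz; nia.
Qed.

Lemma conn_coef_most_connected (K : mgraph) (l : edge K -> nat) k :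
  (forall S : {set edge K}, #|~: S| <= 2 -> connected_by S)%N -> (k <= 2)%N ->
  conn_coef l k = set_coef xpredT l k.
Proof.
move=> cK k2; apply/eqP; rewrite eqn_leq; apply/andP; split; apply: set_coef_le => // S _ Sk.
by apply: cK; rewrite Sk.
Qed.

Lemma cubic_card_edge (D : mgraph) k : cubic D -> #|vertex D| = (2 * k)%N -> #|edge D| = (3 * k)%N.
Proof.
move=> Dc Vk; suff : (#|vertex D| * 3 = 2 * #|edge D|)%N by lia.
by rewrite -sum_nat_const -sum_degree; apply: eq_bigr => v _; rewrite Dc.
Qed.

(** The rival is a Moebius ladder with lengths [q] except one [q + s]. Its coefficients of degree at
    most 2 are the full elementary symmetric ones, so comparing them in turn constrains [l]. *)
Lemma most_reliable_core (R : realType) (G : mgraph) k q s :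
  (0 < k)%N -> uniformly_most_reliable R G -> (#|edge G| = #|vertex G| + k)%N ->
  (0 < q)%N -> (#|edge G| = 3 * k * q + s)%N ->
  exists (D : mgraph) (l : edge D -> nat),
    [/\ cubic D, #|vertex D| = (2 * k)%N, (forall e, l e <= q + s)%N &
     forall (K : mgraph) (l' : edge K -> nat) (x : R),
      #|vertex K| = (2 * k)%N -> #|edge K| = (3 * k)%N -> (forall e, 0 < l' e)%N ->
      (\sum_e l' e = #|edge G|)%N -> 0 <= x -> length_poly x l' <= length_poly x l].
Proof.
move=> k0 mG cG q0 Eq.
have cmp (K : mgraph) (l' : edge K -> nat) (x : R) :
    #|vertex K| = (2 * k)%N -> #|edge K| = (3 * k)%N -> (forall e, 0 < l' e)%N ->
    (\sum_e l' e = #|edge G|)%N -> 0 <= x ->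
    length_poly x l' <= @length_poly R x G (fun=> 1%N).
  move=> VK EK l0 sl x0; apply: most_reliable_length_poly => //; lia.
pose M := moebius_ladder k0.
have VM : #|vertex M| = (2 * k)%N by rewrite card_ord.
have EM : #|edge M| = (3 * k)%N := card_moebius_edge k0.
have cM : forall S : {set edge M}, (#|~: S| <= 2)%N -> connected_by S.
  exact: moebius_connected.
pose e0 : edge M := inr (Ordinal k0).
pose lM (e : edge M) := if e == e0 then (q + s)%N else q.
have lM0 e : (0 < lM e)%N by rewrite /lM; case: ifP; lia.
have slM : (\sum_e lM e = #|edge G|)%N.
  by apply/eqP; rewrite -(eqn_add2r q) sum_eq_or_const EM Eq addnA addnAC.
have coefM i := @conn_coef_most_connected M lM i cM.
have low (D : mgraph) (l : edge D -> nat) :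
    (forall x : R, 0 <= x -> length_poly x lM <= length_poly x l) ->
    forall i, (forall j, (j < i)%N -> conn_coef lM j = conn_coef l j) ->
    (conn_coef lM i <= conn_coef l i)%N.
  move=> le i eqi; rewrite -(ler_nat R) -!coef_length_poly; apply: ler_coef_low.
    by move=> x x0; rewrite !horner_length_poly le // ltW.
  by move=> j ji; rewrite !coef_length_poly eqi.
(* The constant coefficient counts the full edge set if it is connected, and the ladder has 1
   there. *)
have conG : connected_by [set: edge G].
  have := low G (fun=> 1%N) (fun x => cmp M lM x VM EM lM0 slM) 0%N (fun _ => ltac:(by [])).
  rewrite coefM //; have [-> _ _] := set_coefT lM.
  apply: contraTT => nG; rewrite /conn_coef /set_coef big_pred0 // => S.
  apply/negP => /andP [cS]; rewrite cards_eq0 => /eqP S0.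
  by case/negP: nG; rewrite -(setCK S) S0 setC0 in cS.
have [D [l [Dc VD sl Dl]]] : cubic_core ('X : {poly R}) k.+1 (fun _ : edge G => 1%N).
  apply: cubic_core_connected => //; lia.
rewrite subn1 /= in VD.
have {}sl : (\sum_e l e <= #|edge G|)%N by rewrite -sum1_card.
have GD (x : R) : @length_poly R x G (fun=> 1%N) = length_poly x l.
  by rewrite -(horner_length_poly (fun _ : edge G => 1%N)) -(horner_length_poly l) Dl.
have ED := cubic_card_edge Dc VD.
have cmpD (K : mgraph) (l' : edge K -> nat) (x : R) :
    #|vertex K| = (2 * k)%N -> #|edge K| = (3 * k)%N -> (forall e, 0 < l' e)%N ->
    (\sum_e l' e = #|edge G|)%N -> 0 <= x -> length_poly x l' <= length_poly x l.
  by move=> *; rewrite -GD; apply: cmp.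
exists D, l; split=> //.
have {low} low := low D l (fun x => cmpD M lM x VM EM lM0 slM).
have upper i : (conn_coef l i <= set_coef xpredT l i)%N by apply: set_coef_le.
have [M0 M1 M2] := set_coefT lM; have [D0 D1 D2] := set_coefT l.
have e0E : conn_coef lM 0 = conn_coef l 0.
  have := low 0%N (fun _ => ltac:(by [])); have := upper 0%N.
  rewrite coefM // M0 D0; lia.
(* The linear coefficient forces the core to keep the whole length of [G]. *)
have low1 : (conn_coef lM 1 <= conn_coef l 1)%N by apply: low => -[].
have e1E : conn_coef lM 1 = conn_coef l 1.
  move: low1; have := upper 1%N; rewrite coefM // M1 D1; lia.
(* With equal sums, a larger second symmetric function means a smaller sum of squares. *)
have low2 : (conn_coef lM 2 <= conn_coef l 2)%N by apply: low => -[|[]].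
have suml : (\sum_e l e = \sum_e lM e)%N.
  move: e1E; have := upper 1%N; rewrite coefM // M1 D1; lia.
apply: (@le_of_sum_sqr_le _ _ l q s e0); [by rewrite ED EM|exact: suml|].
suff : (\sum_e l e ^ 2 <= \sum_e lM e ^ 2)%N by [].
move: low2 M2 D2; have := upper 2%N; rewrite coefM // suml; lia.
Qed.

(** * Comparison with subdivisions of the optimal cubic graph *)

Lemma card_set_of (T : finType) : #|{: {set T}}| = (2 ^ #|T|)%N.
Proof. by rewrite -[#|T|]cardsT -card_powerset powersetT cardsT. Qed.

Lemma conn_coef_one_le (G : mgraph) i :
  (@conn_coef G (fun=> 1%N) i <= 2 ^ #|edge G|)%N.
Proof.
rewrite -card_set_of -sum1_card /conn_coef /set_coef big_mkcond; apply: leq_sum => S _.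
by case: ifP => // _; rewrite big1.
Qed.

Lemma length_poly_one_le (R : realFieldType) (G : mgraph) (y : R) : 0 <= y <= 1 ->
  @length_poly R y G (fun=> 1%N) <= (2 ^ #|edge G|)%:R.
Proof.
move=> /andP [y0 y1].
rewrite -card_set_of -sum1_card natr_sum /length_poly /conn_poly big_mkcond.
apply: ler_sum => S _; case: ifP => // _.
by rewrite prodr_const mul1r exprn_ile1.
Qed.

Lemma length_poly_le (R : realFieldType) (G : mgraph) (l l' : edge G -> nat) (x y : R) :
  0 <= x -> 0 <= y -> (forall e, (l e)%:R * x <= (l' e)%:R * y) ->
  length_poly x l <= length_poly y l'.
Proof.
move=> x0 y0 ll'; apply: ler_sum => S _; apply: ler_prod => e _.
by rewrite mulr_ge0 ?ll'.
Qed.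

Lemma length_poly_one_scale (R : realFieldType) (G : mgraph) (t y : R) : 1 <= t -> 0 <= y ->
  @length_poly R (t * y) G (fun=> 1%N) <= t ^+ #|edge G| * @length_poly R y G (fun=> 1%N).
Proof.
move=> t1 y0; rewrite /length_poly /conn_poly mulr_sumr; apply: ler_sum => S _.
rewrite !prodr_const !mul1r exprMn ler_wpM2r ?exprn_ge0 // ler_weXn2l //.
exact: max_card.
Qed.

(** The lowest nonzero coefficient is an integer, and it is positive by the sign near 0, hence at
    least 1. Up to [y] the other terms cost at most half of the lowest one. The point [y] depends on
    [n] and [B] only, not on [p] or [eps]. *)
Lemma horner_integral_gap (R : realFieldType) (p : {poly R}) n (B eps : R) :
  let y := (2%:R * n.+1%:R * B)^-1 in
  (size p <= n.+1)%N -> 1 <= B -> (forall i, `|p`_i| <= B) ->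
  (forall i, exists z : int, p`_i = z%:~R) -> p != 0 ->
  0 < eps -> (forall x, 0 < x <= eps -> 0 <= p.[x]) ->
  y ^+ n / 2%:R <= p.[y].
Proof.
move=> y sp B1 pB pZ p0 eps0 peps.
have ex : exists i, p`_i != 0.
  by exists (size p).-1; rewrite -lead_coefE lead_coef_eq0.
have [k pk kmin] := ex_minnP ex.
have plow i : (i < k)%N -> p`_i = 0.
  by move=> ik; apply/eqP; apply: contraTT ik => /kmin; rewrite -leqNgt.
have n1 : 1 <= n.+1%:R :> R by rewrite ler1n.
have den : 1 < 2%:R * n.+1%:R * B by nra.
have y0 : 0 < y by rewrite invr_gt0; lra.
have y1 : y <= 1 by rewrite invf_le1; lra.
have yE : n.+1%:R * B * y = 2%:R^-1.
  by rewrite /y; field; lra.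
have near x : 0 < x <= y -> `|p.[x] - p`_k * x ^+ k| <= x ^+ k / 2%:R.
  move=> /andP [x0 xy]; have x01 : 0 <= x <= 1 by rewrite (ltW x0) (le_trans xy y1).
  apply: le_trans (norm_horner_low sp pB plow x01) _.
  rewrite exprS mulrA [leRHS]mulrC ler_pM2r ?exprn_gt0 // -yE ler_wpM2l //; nra.
have kn : (k <= n)%N.
  by rewrite -ltnS; apply: leq_trans sp; rewrite ltnNge; apply: contraNN pk => /(nth_default 0) ->.
have [pos|neg|/eqP] := ltgtP 0 p`_k; last by rewrite eq_sym (negbTE pk).
  have pk1 : 1 <= p`_k.
    have [z zE] := pZ k; rewrite zE in pos *.
    by move: pos; rewrite ltr0z ler1z.
  have := near y; rewrite y0 lexx => /(_ isT); rewrite ler_norml => /andP [+ _] => lo.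
  have yk : 0 < y ^+ k by rewrite exprn_gt0.
  have ykn : y ^+ n <= y ^+ k by rewrite ler_wiXn2l // ltW.
  nra.
have pk1 : p`_k <= -1.
  have [z zE] := pZ k; rewrite zE in neg *.
  by move: neg; rewrite ltrz0 -(intrN _ 1) ler_int; lia.
(* A negative lowest coefficient would make [p] negative at this point. *)
pose x := Num.min y eps.
have x0 : 0 < x by rewrite lt_min y0.
have := near x; rewrite x0 ge_min lexx => /(_ isT); rewrite ler_norml => /andP [_ up].
have := peps x; rewrite x0 ge_min lexx orbT => /(_ isT) px.
have xk : 0 < x ^+ k by rewrite exprn_gt0.
nra.
Qed.

(** At [x = y / q] the lengths rescale to about 1, so the comparison of [l'] with [l] gives
    [F_H(y) <= ((q + a) / q) ^ N * F_D(y)]. For large [q] this excess is below the gap that distinct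
    polynomials would leave at [y]. The bound [Q] is fixed before [D] and [H]. *)
Lemma conn_coef_one_eq (R : realType) (N a : nat) : exists Q : nat, forall q, (Q <= q)%N ->
  forall (D H : mgraph) (l : edge D -> nat) (l' : edge H -> nat) (eps : R),
    #|edge D| = N -> #|edge H| = N ->
    (forall e, l e <= q + a)%N -> (forall e, q <= l' e)%N ->
    (forall x : R, 0 <= x -> length_poly x l' <= length_poly x l) -> 0 < eps ->
    (forall x : R, 0 < x <= eps ->
       @length_poly R x D (fun=> 1%N) <= @length_poly R x H (fun=> 1%N)) ->
    forall i, @conn_coef D (fun=> 1%N) i = @conn_coef H (fun=> 1%N) i.
Proof.
pose B : R := (2 ^ N)%:R.
have B1 : 1 <= B by rewrite ler1n expn_gt0.
pose y := (2%:R * N.+1%:R * B)^-1.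
have den : 1 < 2%:R * N.+1%:R * B.
  have : 1 <= N.+1%:R :> R by rewrite ler1n.
  nra.
have y0 : 0 < y by rewrite invr_gt0; lra.
have y1 : y <= 1 by rewrite invf_le1; lra.
pose c : R := ((a + 1) ^ N.+1)%:R.
have c0 : 0 <= c by [].
pose delta := y ^+ N / 2%:R.
have delta0 : 0 < delta by rewrite divr_gt0 ?exprn_gt0.
(* The excess is at most [B * c / q], which must fall below [delta]. *)
exists (Num.bound (B * c / delta)).+1 => q Qq D H l l' eps ED EH lq ql' le eps0 near.
apply: contrapT => neq.
pose P (G : mgraph) := @length_poly {poly R} 'X G (fun=> 1%N).
have PE (G : mgraph) i : (P G)`_i = (@conn_coef G (fun=> 1%N) i)%:R by apply: coef_length_poly.
have gap : delta <= (P H - P D).[y].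
  apply: (@horner_integral_gap R (P H - P D) N B eps) => //.
  - apply/leq_sizeP => j Nj; rewrite coefB !PE.
    have z (G : mgraph) : #|edge G| = N -> @conn_coef G (fun=> 1%N) j = 0%N.
      move=> EG; rewrite /conn_coef /set_coef big_pred0 // => S.
      apply/negP => /andP [_ /eqP Sj]; have := max_card (mem (~: S)).
      rewrite Sj EG; lia.
    by rewrite !z // subrr.
  - move=> i; rewrite coefB !PE; have := conn_coef_one_le D i; have := conn_coef_one_le H i.
    rewrite ED EH -!(ler_nat R) -/B.
    have : 0 <= (@conn_coef D (fun=> 1%N) i)%:R :> R by [].
    have : 0 <= (@conn_coef H (fun=> 1%N) i)%:R :> R by [].
    move=> *; rewrite ler_norml; lra.
  - move=> i; exists ((@conn_coef H (fun=> 1%N) i)%:Z - (@conn_coef D (fun=> 1%N) i)%:Z).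
    by rewrite coefB !PE intrB.
  - apply/eqP => PP; apply: neq => i; apply/eqP; rewrite -(eqr_nat R) -!PE.
    by rewrite eq_sym -subr_eq0 -coefB PP coef0.
  - by move=> x xe; rewrite hornerD hornerN subr_ge0 !horner_length_poly near.
rewrite hornerD hornerN !horner_length_poly in gap.
have q0 : (0 < q)%N by apply: leq_trans Qq.
have q0R : 0 < q%:R :> R by rewrite ltr0n.
pose t : R := (q + a)%:R / q%:R.
have t1 : 1 <= t by rewrite ler_pdivlMr // mul1r ler_nat leq_addr.
have qy0 : 0 <= y / q%:R by rewrite divr_ge0 // ltW.
have upD : length_poly (y / q%:R) l <= t ^+ N * @length_poly R y D (fun=> 1%N).
  rewrite -{1}ED; apply: le_trans (length_poly_one_scale D t1 (ltW y0)).
  apply: length_poly_le => //; first by rewrite mulr_ge0 // ?(ltW y0) // (le_trans _ t1).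
  by move=> e; rewrite mul1r /t mulrAC mulrA ler_pM2r ?invr_gt0 // ler_pM2r // ler_nat.
have loH : @length_poly R y H (fun=> 1%N) <= length_poly (y / q%:R) l'.
  apply: length_poly_le => //; first exact: ltW.
  move=> e; rewrite mul1r mulrA ler_pdivlMr // mulrC ler_pM2r // ler_nat //.
have DB : @length_poly R y D (fun=> 1%N) <= B.
  by rewrite /B -ED length_poly_one_le // (ltW y0).
have tN : t ^+ N <= 1 + c / q%:R.
  have tq : t ^+ N <= t ^+ N.+1 by rewrite ler_weXn2l.
  apply: le_trans tq _; rewrite /t expr_div_n ler_pdivrMr ?exprn_gt0 // mulrDl mul1r.
  rewrite [in leRHS]exprS mulrA divfK ?lt0r_neq0 // -exprS /c -!natrX -natrM -natrD ler_nat.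
  exact: leq_trans (leq_addr _ _) (expn_add_le a N q0).
have t0 : 1 <= t ^+ N by rewrite exprn_ege1.
have lex := le _ qy0.
have Dpos : 0 <= @length_poly R y D (fun=> 1%N).
  by apply: sumr_ge0 => S _; apply: prodr_ge0 => e _; rewrite mul1r ltW.
have dc : delta <= c / q%:R * B by nra.
have : (Num.bound (B * c / delta))%:R < q%:R :> R by rewrite ltr_nat.
have := archi_boundP (_ : 0 <= B * c / delta).
rewrite !mulr_ge0 ?invr_ge0 ?(ltW delta0) ?(le_trans ler01 B1) // => /(_ isT) b1 b2.
have := lt_trans b1 b2; rewrite ltr_pdivrMr // => lt1.
move: dc; rewrite mulrAC ler_pdivlMr //; nra.
Qed.

(** * Cotrees and the transfer of length between two edges *)

Lemma prod_two_values (T : finType) (A : {set T}) (e1 e2 : T) (a b q : nat) : e1 != e2 ->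
  (\prod_(e in A) (if e == e1 then a else if e == e2 then b else q) =
   a ^ (e1 \in A) * (b ^ (e2 \in A) * q ^ #|A :\ e1 :\ e2|))%N.
Proof.
move=> e12.
have D1 (B : {set T}) (f : T -> nat) e :
    (\prod_(x in B) f x = f e ^ (e \in B) * \prod_(x in B :\ e) f x)%N.
  have [eB|eB] := boolP (e \in B); first by rewrite (big_setD1 e) //= expn1.
  rewrite expn0 mul1n; apply: eq_bigl => x; rewrite !inE.
  by case: eqVneq => // ->; rewrite (negbTE eB).
rewrite (D1 A _ e1) eqxx (D1 (A :\ e1) _ e2) eq_sym (negbTE e12) eqxx.
congr (_ * (_ ^ _ * _))%N; first by rewrite !inE eq_sym e12.
rewrite -prod_nat_const; apply: eq_bigr => x; rewrite !inE => /and3P [/negbTE -> /negbTE -> _] //.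
Qed.

(** When [r] is the number of redundant edges, these sets are the spanning trees avoiding [e], so
    the count is [T(G - e)]. *)
Definition cotrees_through (G : mgraph) (r : nat) (e : edge G) : nat :=
  #|[set S : {set edge G} | [&& connected_by S, #|~: S| == r & e \notin S]]|.

(* Moving length [K] from [e2] to [e1] gains about [q ^ j.+1 * K] since more cotrees
   contain [e1], while lengthening every edge by [s] gains [O(q ^ j.+1)]
   independently of [K]. *)
Lemma conn_coef_transfer_gain (G : mgraph) (j : nat) (e1 e2 : edge G) (N : nat) :
  (cotrees_through j.+2 e2 < cotrees_through j.+2 e1)%N ->
  exists K Q : nat, forall q s, (Q <= q)%N -> (s <= N)%N ->
    (K < q)%N /\
    (@conn_coef G (fun=> 1) j.+2 * (q + s) ^ j.+2 <
     conn_coef (fun e => if e == e1 then q + K + s else if e == e2 then q - K else q) j.+2)%N.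
Proof.
move=> lt12; have e12 : e1 != e2 by apply: contraTneq lt12 => ->; rewrite ltnn.
pose T := @conn_coef G (fun=> 1%N) j.+2; pose B := ((N + 1) ^ j.+2)%N.
(* The first part of [K] pays for lengthening all edges by [s], which costs at most
   [T * B * q ^ j.+1]; the extra 1 leaves a surplus [q ^ j.+1]. *)
pose K := (T * B + 1)%N.
(* For such [q] the surplus exceeds the second-order loss [T * (K * (K + s)) * q ^ j], and [q - K]
   stays positive. *)
exists K, (T * (K * (K + N)) + K + 1)%N => q s Qq sN.
have Kq : (K < q)%N by apply: leq_trans Qq; rewrite addn1 ltnS leq_addl.
split=> //; rewrite -/T; set l := fun e => if e == e1 then _ else _.
pose ok (S : {set edge G}) := connected_by S && (#|~: S| == j.+2).
have cot e : cotrees_through j.+2 e = (\sum_(S | ok S) (e \notin S))%N.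
  rewrite /cotrees_through -sum1dep_card [RHS]big_mkcond [LHS]big_mkcond.
  apply: eq_bigr => S _; rewrite /ok.
  by case: connected_by => //; case: eqP => // _; case: (e \notin S).
have TE : T = (\sum_(S | ok S) 1)%N.
  by apply: eq_bigr => S _; rewrite big1.
(* Checked cotree by cotree: one through [e1] gains [q ^ j.+1 * (K + s)], one through [e2] loses
   [q ^ j.+1 * K], and one through both loses in addition [q ^ j * K * (K + s)]. The losses stand on
   the right to avoid subtraction. *)
have main : (q ^ j * (T * q ^ 2 + q * (K + s) * cotrees_through j.+2 e1) <=
   conn_coef l j.+2 + q ^ j * (K * q * cotrees_through j.+2 e2 + T * (K * (K + s))))%N.
  rewrite !cot TE !(big_distrl, big_distrr) /= -!big_split /= !big_distrr /= -big_split /=.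
  apply: leq_sum => S /andP [_ /eqP Sj].
  rewrite /l prod_two_values // !inE.
  have c1 := cardsD1 e1 (~: S); have c2 := cardsD1 e2 (~: S :\ e1).
  rewrite !inE Sj in c1 c2; rewrite eq_sym e12 /= in c2.
  have [z qz] : exists z, q = (K + z)%N by exists (q - K)%N; rewrite subnKC // ltnW.
  have -> : (q - K = z)%N by rewrite qz addKn.
  move: c1 c2; case: (e1 \notin S); case: (e2 \notin S) => /= c1 c2.
  - have -> : #|~: S :\ e1 :\ e2| = j by lia.
    rewrite !expn1; move: (q ^ j)%N => Y; rewrite qz; nia.
  - have -> : #|~: S :\ e1 :\ e2| = j.+1 by lia.
    rewrite !expn1 expn0 [(q ^ j.+1)%N]expnS; move: (q ^ j)%N => Y; nia.
  - have -> : #|~: S :\ e1 :\ e2| = j.+1 by lia.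
    rewrite !expn1 expn0 [(q ^ j.+1)%N]expnS; move: (q ^ j)%N => Y; rewrite qz; nia.
  - have -> : #|~: S :\ e1 :\ e2| = j.+2 by lia.
    rewrite !expn0 [(q ^ j.+2)%N]expnS [(q ^ j.+1)%N]expnS; move: (q ^ j)%N => Y; nia.
have q0 : (0 < q)%N by apply: leq_ltn_trans Kq.
have up : (T * (q + s) ^ j.+2 <= q ^ j * (T * q ^ 2 + T * B * q))%N.
  have := expn_add_le s j.+1 q0.
  have : ((s + 1) ^ j.+2 <= B)%N by rewrite leq_exp2r // leq_add2r.
  rewrite (_ : q ^ j * _ = T * (q ^ j.+2 + B * q ^ j.+1))%N; last by rewrite !expnS; ring.
  move=> sB le; rewrite leq_mul2l; apply/orP; right.
  apply: leq_trans (leq_addr (q ^ j.+1) _) (leq_trans le _).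
  by rewrite leq_add2l leq_mul2r sB orbT.
have key : (T * q ^ 2 + T * B * q + (K * q * cotrees_through j.+2 e2 + T * (K * (K + s)))
   < T * q ^ 2 + q * (K + s) * cotrees_through j.+2 e1)%N.
  have h1 : (T * (K * (K + s)) <= T * (K * (K + N)))%N.
    by rewrite !leq_mul2l leq_add2l sN !orbT.
  have h2 : (q * K * cotrees_through j.+2 e2 + q * K <= q * (K + s) * cotrees_through j.+2 e1)%N.
    by rewrite -mulnSr leq_mul // leq_mul2l leq_addr orbT.
  have h3 : (q * K = T * B * q + q)%N by rewrite /K; ring.
  rewrite [(K * q)%N]mulnC; move: h1 h2 h3 Qq; clear; lia.
have qj : (0 < q ^ j)%N by rewrite expn_gt0 q0.
move: key; rewrite -(ltn_pmul2l qj) mulnDr => key.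
rewrite -(ltn_add2r (q ^ j * (K * q * cotrees_through j.+2 e2 + T * (K * (K + s))))).
by apply: leq_trans main; apply: leq_ltn_trans key; rewrite leq_add2r.
Qed.

(** A connected set misses at most [r] edges, so the polynomial has degree at most [r] and
    [ler_coef_top] applies there. *)
Lemma conn_coef_corank (G : mgraph) (l : edge G -> nat) i r :
  (0 < #|vertex G|)%N -> (#|edge G| + 1 = #|vertex G| + r)%N -> (r < i)%N ->
  conn_coef l i = 0%N.
Proof.
move=> V0 cG ri; rewrite /conn_coef /set_coef big_pred0 // => S.
apply/negP => /andP [cS /eqP Si]; have [+ _] := connected_by_card V0 cS.
have := cardsC S; rewrite Si; lia.
Qed.

Lemma conn_coef_le_expn (G : mgraph) (l : edge G -> nat) L i :
  (forall e, l e <= L)%N -> (conn_coef l i <= @conn_coef G (fun=> 1) i * L ^ i)%N.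
Proof.
move=> lL; rewrite /conn_coef /set_coef big_distrl; apply: leq_sum => S /andP [_ /eqP <-].
by rewrite [X in (_ <= X * _)%N]big1 // mul1n -prod_nat_const leq_prod.
Qed.

Lemma nb_spanning_trees_cotrees (G : mgraph) (e : edge G) r :
  (0 < #|vertex G|)%N -> (#|edge G| + 1 = #|vertex G| + r)%N ->
  nb_spanning_trees (remove_edge e) = cotrees_through r e.
Proof.
move=> V0 cG; rewrite nb_spanning_trees_remove_edge //; apply: eq_card => S.
rewrite !inE; congr (_ && _); rewrite andbC; congr (_ && _).
have cS := cardsC S; apply/eqP/eqP => [SV|SV]; lia.
Qed.

Lemma sum_transfer (T : finType) (e1 e2 : T) (K q s : nat) : e1 != e2 -> (K <= q)%N ->
  (\sum_e (if e == e1 then q + K + s else if e == e2 then q - K else q) = #|T| * q + s)%N.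
Proof.
move=> e12 Kq; have h1 := sum_eq_or_const e1 (q + K + s) q.
have h2 := sum_eq_or_const e2 K 0.
have : (\sum_e (if e == e1 then q + K + s else if e == e2 then q - K else q) +
    \sum_e (if e == e2 then K else 0) = \sum_e (if e == e1 then q + K + s else q))%N.
  rewrite -big_split; apply: eq_bigr => e _ /=.
  have [->|_] := eqVneq e e1; first by rewrite (negbTE e12) addn0.
  by case: ifP => _; rewrite ?addn0 // subnK.
move: h1 h2; rewrite muln0 !addn0.
move: (\sum_e _)%N (\sum_e _)%N (\sum_e _)%N => a b c; lia.
Qed.

(** Since [x / (1 + x) <= x], the bound on [p] serves unchanged as a bound on [x]. *)
Lemma cubic_most_reliable_length_poly (R : realType) (H D : mgraph) :
  most_reliable_cubic_near_zero R H -> cubic D -> #|vertex D| = #|vertex H| ->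
  exists2 eps : R, 0 < eps & forall x, 0 < x <= eps ->
    @length_poly R x D (fun=> 1%N) <= @length_poly R x H (fun=> 1%N).
Proof.
move=> [Hc [eps eps0 Hmin]] Dc VD; exists eps => // x /andP [x0 xe].
have EE : #|edge H| = #|edge D|.
  have sum3 (G : mgraph) : cubic G -> (#|vertex G| * 3 = 2 * #|edge G|)%N.
    by move=> Gc; rewrite -sum_nat_const -sum_degree; apply: eq_bigr => v _; rewrite Gc.
  by have := sum3 H Hc; have := sum3 D Dc; rewrite VD; lia.
have x1 : 0 < 1 + x by rewrite ltr_wpDr // ltW.
apply: length_poly_of_unreliability => //; first exact: ltW.
apply: Hmin => //; rewrite divr_ge0 ?(ltW x0) ?(ltW x1) //= ler_pdivrMr //.
nra.
Qed.

Local Close Scope ring_scope.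

Theorem lemma4p9 (R : realType) (r : nat) (hr : 1 < r) (H : mgraph)
  (hHn : #|vertex H| = 2 * (r - 1))
  (hH : most_reliable_cubic_near_zero R H)
  (hHb : ~ tree_balanced H) :
  exists n0 : nat, forall n : nat, n0 < n ->
    ~ exists G : mgraph,
        [/\ #|vertex G| = n, redundant_edges G = r%:Z%R
          & uniformly_most_reliable R G].
Proof.
have [j rE] : exists j, r = j.+2 by exists (r - 2)%N; lia.
pose k := j.+1; have VH : #|vertex H| = (2 * k)%N by rewrite hHn rE subn1.
have EH : #|edge H| = (3 * k)%N by apply: cubic_card_edge VH; case: hH.
have V0 (D : mgraph) : #|vertex D| = (2 * k)%N -> (0 < #|vertex D|)%N by move=> ->.
have cE (D : mgraph) : #|vertex D| = (2 * k)%N -> #|edge D| = (3 * k)%N ->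
  (#|edge D| + 1 = #|vertex D| + j.+2)%N by move=> -> ->; rewrite /k; lia.
have [e1 [e2 lt12]] : exists e1 e2 : edge H,
    (cotrees_through j.+2 e2 < cotrees_through j.+2 e1)%N.
  apply: contrapT => nlt; apply: hHb => e1 e2.
  rewrite !(@nb_spanning_trees_cotrees H _ j.+2) ?V0 ?cE //.
  have [lt|lt|//] := ltngtP (cotrees_through j.+2 e1) (cotrees_through j.+2 e2).
    by case: nlt; exists e2, e1.
  by case: nlt; exists e1, e2.
have e12 : e1 != e2 by apply: contraTneq lt12 => ->; rewrite ltnn.
pose N := (3 * k)%N; have N0 : (0 < N)%N by [].
have [Q1 one_eq] := conn_coef_one_eq R N N.
have [K [Q2 gain]] := conn_coef_transfer_gain N lt12.
(* As [G] has at least [n] edges, the quotient [q] of its size by [N] then passes both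
   thresholds. *)
exists (N * (Q1 + Q2 + 1))%N => n nQ [G [VG rG mG]].
have EG : #|edge G| = (#|vertex G| + k)%N.
  by move: rG; rewrite /redundant_edges rE /k; lia.
pose q := (#|edge G| %/ N)%N; pose s := (#|edge G| %% N)%N.
have EGq : #|edge G| = (N * q + s)%N by rewrite mulnC -divn_eq.
have sN : (s <= N)%N by rewrite ltnW // ltn_pmod.
have qQ : (Q1 + Q2 + 1 <= q)%N.
  by rewrite leq_divRL // EG VG mulnC ltnW // ltn_addr.
have q0 : (0 < q)%N by lia.
have [D [l [Dc VD lq lcmp]]] := most_reliable_core (ltn0Sn j) mG EG q0 EGq.
have ED : #|edge D| = (3 * k)%N := cubic_card_edge Dc VD.
have [Kq lt_gain] := gain q s (leq_trans (leq_trans (leq_addl _ _) (leq_addr _ _)) qQ) sN.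
have [eps eps0 near] := cubic_most_reliable_length_poly hH Dc (etrans VD (esym VH)).
(* First comparison: an almost balanced subdivision of [H] shows that [D] and [H] have the same
   polynomial. *)
have DH : forall i, @conn_coef D (fun=> 1%N) i = @conn_coef H (fun=> 1%N) i.
  pose lH (e : edge H) := if e == e1 then (q + s)%N else q.
  apply: (one_eq q _ D H l lH eps) => //.
  - by rewrite (leq_trans (leq_addr _ _) (leq_trans (leq_addr _ _) qQ)) // addnA leq_addr.
  - by move=> e; apply: leq_trans (lq e) _; rewrite leq_add2l.
  - by move=> e; rewrite /lH; case: ifP; rewrite ?leq_addr.
  - move=> x x0; apply: lcmp => //.
      by move=> e; rewrite /lH; case: ifP => // _; rewrite ltn_addr.
    have := sum_eq_or_const e1 (q + s) q; rewrite EH -/N EGq addnA => /eqP.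
    by rewrite addnAC eqn_add2r => /eqP.
(* Second comparison: the unbalanced subdivision of [H], of the same total length, is tested on the
   top coefficient, the number of spanning trees. *)
pose lK (e : edge H) := if e == e1 then (q + K + s)%N else if e == e2 then (q - K)%N else q.
have lK0 e : (0 < lK e)%N by rewrite /lK; case: ifP => _; [|case: ifP => _]; lia.
have slK : (\sum_e lK e = #|edge G|)%N by rewrite sum_transfer ?(ltnW Kq) // EH EGq.
have sizeP (C : mgraph) (m : edge C -> nat) : #|vertex C| = (2 * k)%N ->
    #|edge C| = (3 * k)%N -> (size (length_poly ('X : {poly R})%R m) <= j.+3)%N.
  move=> VC EC; apply/leq_sizeP => i ji.
  by rewrite coef_length_poly (conn_coef_corank _ (V0 C VC) (cE C VC EC)).
have := @ler_coef_top R (length_poly 'X lK)%R (length_poly 'X l)%R j.+2 (sizeP _ _ VH EH) (sizeP _ _ VD ED).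
rewrite !coef_length_poly ler_nat => top.
have : (conn_coef lK j.+2 <= conn_coef l j.+2)%N.
  by apply: top => x x0; rewrite !horner_length_poly lcmp // ltW.
(* Since all [l e <= q + s] and [D] has as many spanning trees as [H], the top coefficient for [l]
   is at most the bound beaten by the transfer. *)
apply/negP; rewrite -ltnNge; apply: leq_ltn_trans lt_gain.
by rewrite -DH; apply: conn_coef_le_expn.
Qed.
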